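(* Let $\tau,\sigma\in\mathbb{C}$ with $\operatorname{Im}\tau>0$ and $\operatorname{Im}\sigma>0$, and let $n\ge 1$ be a natural number such that $n\tau\notin\mathbb{Z}+\mathbb{Z}\sigma$ (so that $\theta_0(\tau,\sigma)\neq 0$ and $\theta_0(n\tau,\sigma)\ne 0$). Then, as an identity of meromorphic functions of $z\in\mathbb{C}$, \[ \bar\Gamma(nz,\tau,\sigma)\ \prod_{k=1}^{n-1}\bar\Gamma\Big(\frac{k}{n},\,n\tau,\,\sigma\Big)\ =\ \left(\frac{\theta_0(n\tau,\sigma)}{\theta_0(\tau,\sigma)}\right)^{nz-1}\ \prod_{k=0}^{n-1}\bar\Gamma\Big(z+\frac{k}{n},\,n\tau,\,\sigma\Big). \]
   Context: For complex $x,q$ with $|q|<1$ put $(x;q)=\prod_{j=0}^\infty(1-xq^j)$. For $z,\sigma\in\mathbb{C}$ with $\operatorname{Im}\sigma>0$, the theta function is $\theta_0(z,\sigma)=(x;r)\,(r/x;r)$, where $x=e^{2\pi i z}$ and $r=e^{2\pi i\sigma}$. It vanishes exactly when $z\in\mathbb{Z}+\mathbb{Z}\sigma$. For $\operatorname{Im}\tau>0$ and $\operatorname{Im}\sigma>0$, the elliptic gamma function (not the Euler gamma function) is the meromorphic function defined by the convergent infinite product \[ \Gamma(z,\tau,\sigma)=\prod_{j,k=0}^{\infty}\frac{1-e^{2\pi i((j+1)\tau+(k+1)\sigma-z)}}{1-e^{2\pi i(j\tau+k\sigma+z)}}. \] The function $\bar\Gamma$ is defined, when $\theta_0(\tau,\sigma)\neq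 0$, by \[ \bar\Gamma(z,\tau,\sigma)=\frac{(q;q)}{(r;r)}\ \theta_0(\tau,\sigma)^{1-z}\ \Gamma(z\tau,\tau,\sigma),\qquad q=e^{2\pi i\tau},\ r=e^{2\pi i\sigma}. \] Thus $\bar\Gamma(z,n\tau,\sigma)=\frac{(q^n;q^n)}{(r;r)}\,\theta_0(n\tau,\sigma)^{1-z}\,\Gamma(nz\tau,n\tau,\sigma)$. Convention on complex powers: fix one logarithm $L_1$ of $\theta_0(\tau,\sigma)$ and one logarithm $L_n$ of $\theta_0(n\tau,\sigma)$ (with $L_n=L_1$ if $n=1$). For all complex $s$, set $\theta_0(\tau,\sigma)^s=e^{sL_1}$, $\theta_0(n\tau,\sigma)^s=e^{sL_n}$ and $\big(\theta_0(n\tau,\sigma)/\theta_0(\tau,\sigma)\big)^s=e^{s(L_n-L_1)}$. Empty products equal $1$. *)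

(* Defs.v *)
From Stdlib Require Import Reals.
From Coquelicot Require Import Coquelicot.
Open Scope C_scope.

Definition Cexp (z : C) : C :=
  (exp (Re z) * cos (Im z), exp (Re z) * sin (Im z))%R.

(** e^(2 pi i z) *)
Definition e2pi (z : C) : C := Cexp (2 * PI * Ci * z).

(** f 0 * f 1 * ... * f (n - 1) *)
Fixpoint Cprod (f : nat -> C) (n : nat) : C :=
  match n with
  | O => 1
  | S m => Cprod f m * f m
  end.

(** The limit of [f] along the filter [F]; meaningful only when it exists. *)
Definition Clim {T : Type} (F : (T -> Prop) -> Prop) (f : T -> C) : C :=
  @iota C_CompleteNormedModule (fun l : C => filterlim f F (locally l)).

Definition Cinfprod (f : nat -> C) : C := Clim eventually (Cprod f).

(** The limit of the products over j < M, k < N as M and N tend to infinity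
    independently of each other. *)
Definition Cinfprod2 (f : nat -> nat -> C) : C :=
  Clim (filter_prod eventually eventually)
    (fun MN : nat * nat =>
       Cprod (fun j => Cprod (fun k => f j k) (snd MN)) (fst MN)).

(** (x; q), for |q| < 1 *)
Definition qpoch (x q : C) : C := Cinfprod (fun j => 1 - x * q ^ j).

Definition theta0 (z sigma : C) : C :=
  let x := e2pi z in
  let r := e2pi sigma in
  qpoch x r * qpoch (r / x) r.

(** At a pole a denominator is 0 and the value is irrelevant. *)
Definition ell_gamma (z tau sigma : C) : C :=
  Cinfprod2 (fun j k =>
    (1 - e2pi (INR (j + 1) * tau + INR (k + 1) * sigma - z))
    / (1 - e2pi (INR j * tau + INR k * sigma + z))).

(** [L] is the logarithm of [theta0 tau sigma] that fixes the branch of the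
    power: theta0 (tau, sigma) ^ s = exp (s * L). *)
Definition gamma_bar (L z tau sigma : C) : C :=
  let q := e2pi tau in
  let r := e2pi sigma in
  qpoch q q / qpoch r r * Cexp ((1 - z) * L) * ell_gamma (z * tau) tau sigma.

(** Complex differentiability: [ex_derive] over the scalar ring C. *)
Definition Cdifferentiable (f : C -> C) (z : C) : Prop :=
  @ex_derive C_AbsRing C_NormedModule f z.

Definition holomorphic_at (f : C -> C) (z : C) : Prop :=
  locally z (Cdifferentiable f).

(** Around every point, [f] is a quotient of holomorphic functions whose
    denominator has no zero in a punctured neighbourhood; the value of [f] at
    the centre is not constrained. *)
Definition meromorphic (f : C -> C) : Prop :=
  forall z0 : C, exists g h : C -> C,
    holomorphic_at g z0 /\ holomorphic_at h z0 /\
    locally' z0 (fun z => h z <> 0 /\ f z = g z / h z).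

(** Equality of meromorphic functions given by total functions on C: equality
    wherever both are holomorphic, i.e. away from poles, where the values of
    the total functions carry no meaning. *)
Definition meromorphic_eq (f g : C -> C) : Prop :=
  meromorphic f /\ meromorphic g /\
  forall z : C, holomorphic_at f z -> holomorphic_at g z -> f z = g z.

(* Main.v *)
Require Import Defs.
From Stdlib Require Import Reals Lra Lia List Permutation.
From Coquelicot Require Import Coquelicot.
Open Scope C_scope.

(** Put q = e2pi tau, r = e2pi sigma, x = e2pi w, and let dpoch p q x be the
    product of 1 - p^j q^k x over all j, k >= 0, an entire function of x. Away
    from its poles the elliptic gamma function is the quotient
    dpoch q r (q r / x) / dpoch q r x ([ell_gamma_dpoch]), so every identity
    needed comes from regrouping the factors of a convergent product.

    Splitting the index j by its residue mod n writes dpoch q r x as the product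
    of dpoch (q^n) r (q^k x) over k < n ([dpoch_mult]); taken in numerator and
    denominator this gives the multiplication formula for Gamma
    ([ell_gamma_mult]). The constants Gamma (k tau, n tau, sigma) are found from
    dpoch p q x = (x; p) dpoch p q (q x) ([dpoch_shift]): their product over
    1 <= k < n telescopes to (q^n; q^n) / (q; q) ([qpoch_ell_gamma_prod]). What
    remains is to compare exponents of the powers of theta ([gamma_bar_mult]).

    This proves the identity wherever dpoch q r (e2pi (n z tau)) does not vanish.
    That excludes only isolated z ([dpoch_e2pi_neq_0]), so the identity extends by
    continuity to every point at which both sides are holomorphic
    ([holomorphic_eq]).

    dpoch is holomorphic because the partial products have quadratic Taylor
    remainders that are bounded uniformly ([lprod_taylor]), and such a bound
    passes to a pointwise limit ([Cdifferentiable_lim]). *)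

(** * Limits of complex-valued functions *)

(** The topology of C is defined through the product of two copies of R; this
    and the next lemma restate it through the modulus. *)
Lemma locally_Cmod (z : C) (P : C -> Prop) :
  locally z P <-> exists d : R, (0 < d)%R /\ forall y : C, (Cmod (y - z) < d)%R -> P y.
Proof.
  split.
  - intros H; apply locally_C in H; destruct H as [d Hd].
    exists d; split; [apply cond_pos | exact Hd].
  - intros [d [Hd H]]; apply locally_C.
    exists (mkposreal d Hd); exact H.
Qed.

Lemma filterlim_Cmod {T : Type} (F : (T -> Prop) -> Prop) {FF : Filter F}
    (f : T -> C) (l : C) :
  filterlim f F (locally l) <->
  forall eps : R, (0 < eps)%R -> F (fun t => (Cmod (f t - l) < eps)%R).
Proof.
  split.
  - intros H eps Heps; apply (H (fun y => (Cmod (y - l) < eps)%R)).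
    apply locally_Cmod; exists eps; auto.
  - intros H P HP; apply locally_Cmod in HP; destruct HP as [d [Hd HP]].
    apply filter_imp with (2 := H d Hd); auto.
Qed.

Lemma filterlim_Cmult {T : Type} (F : (T -> Prop) -> Prop) {FF : Filter F}
    (f g : T -> C) (l m : C) :
  filterlim f F (locally l) -> filterlim g F (locally m) ->
  filterlim (fun t => f t * g t) F (locally (l * m)).
Proof.
  intros Hf Hg.
  assert (H : filterlim (fun t => mult (K := C_AbsRing) (f t) (g t)) F
    (locally (T := AbsRing_UniformSpace C_AbsRing) (mult (K := C_AbsRing) l m))).
  { refine (filterlim_comp_2 f g _ _ _ (filterlim_mult (K := C_AbsRing) l m)).
    - intros P HP; apply Hf, locally_C, HP.
    - intros P HP; apply Hg, locally_C, HP. }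
  intros P HP; apply H, locally_C, HP.
Qed.

Lemma Clim_unique {T : Type} (F : (T -> Prop) -> Prop) {FF : ProperFilter F}
    (f : T -> C) (l m : C) :
  filterlim f F (locally l) -> filterlim f F (locally m) -> l = m.
Proof. apply (filterlim_locally_unique (V := C_NormedModule) f l m). Qed.

Lemma Clim_eq {T : Type} (F : (T -> Prop) -> Prop) {FF : ProperFilter F}
    (f : T -> C) (l : C) :
  filterlim f F (locally l) -> Clim F f = l.
Proof. apply (iota_filterlim_locally (V := C_CompleteNormedModule) f l). Qed.

(** The Cauchy criterion in the form in which it is met below: f is eventually
    within eps of some constant, which for a product is one of its partial
    products. *)
Lemma Clim_cauchy {T : Type} (F : (T -> Prop) -> Prop) {FF : ProperFilter F}
    (f : T -> C) :
  (forall eps : R, (0 < eps)%R ->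
     exists c : C, F (fun t => (Cmod (f t - c) < eps)%R)) ->
  filterlim f F (locally (Clim F f)).
Proof.
  intros H.
  destruct (proj1 (filterlim_locally_cauchy (U := C_CompleteNormedModule)
    (F := F) f)) as [y Hy].
  - intros eps.
    destruct (H (eps / 2)%R) as [c Hc]; [apply is_pos_div_2 |].
    exists (fun t => (Cmod (f t - c) < eps / 2)%R); split; [exact Hc |].
    intros u v Hu Hv.
    apply C_NormedModule_mixin_compat1.
    change (Cmod (f v - f u) < eps)%R.
    replace (f v - f u) with ((f v - c) + - (f u - c)) by ring.
    eapply Rle_lt_trans; [apply Cmod_triangle |].
    rewrite Cmod_opp; lra.
  - rewrite (Clim_eq F f y Hy); exact Hy.
Qed.

Lemma Cmod_le_lim {T : Type} (F : (T -> Prop) -> Prop) {FF : ProperFilter F}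
    (f : T -> C) (l : C) (c : C) (B : R) :
  filterlim f F (locally l) -> F (fun t => (Cmod (f t - c) <= B)%R) ->
  (Cmod (l - c) <= B)%R.
Proof.
  intros Hl HB; apply le_epsilon; intros eps Heps.
  destruct (filter_ex _ (filter_and _ _ HB
    (proj1 (filterlim_Cmod F f l) Hl eps Heps))) as [t [H1 H2]].
  replace (l - c) with (- (f t - l) + (f t - c)) by ring.
  eapply Rle_trans; [apply Cmod_triangle |].
  rewrite Cmod_opp; lra.
Qed.

(** * Complex differentiability *)

Lemma is_derive_Cmod (f : C -> C) (z d : C) :
  @is_derive C_AbsRing C_NormedModule f z d <->
  forall eps : R, (0 < eps)%R -> exists delta : R, (0 < delta)%R /\
    forall h : C, (Cmod h < delta)%R ->
      (Cmod (f (z + h)%C - f z - h * d) <= eps * Cmod h)%R.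
Proof.
  split.
  - intros [_ H] eps Heps.
    specialize (H z (fun P HP => HP) (mkposreal eps Heps)).
    destruct H as [delta H].
    exists delta; split; [apply cond_pos |]; intros h Hh.
    assert (E : z + h - z = h) by ring.
    specialize (H (z + h)).
    change ((Cmod (z + h - z) < delta)%R ->
      (Cmod (f (z + h)%C - f z - (z + h - z) * d) <= eps * Cmod (z + h - z))%R) in H.
    rewrite E in H; auto.
  - intros H; split; [apply is_linear_scal_l |].
    intros y Hy.
    assert (Ey : z = y).
    { exact (is_filter_lim_locally_unique (K := C_AbsRing)
        (V := AbsRing_NormedModule C_AbsRing) z y Hy). }
    subst y; intros eps.
    destruct (H eps (cond_pos eps)) as [delta [Hdelta Hd]].
    exists (mkposreal delta Hdelta); intros y Hyz.
    change (Cmod (f y - f z - (y - z) * d) <= eps * Cmod (y - z))%R.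
    change (Cmod (y - z) < delta)%R in Hyz.
    replace (f y) with (f (z + (y - z))) by (f_equal; ring).
    auto.
Qed.

Lemma Cdifferentiable_ext (f g : C -> C) (z : C) :
  (forall y, f y = g y) -> Cdifferentiable f z -> Cdifferentiable g z.
Proof. intros H; apply ex_derive_ext; exact H. Qed.

Lemma Cdifferentiable_const (c z : C) : Cdifferentiable (fun _ => c) z.
Proof. exact (ex_derive_const c z). Qed.

(** C as a normed module and C as a normed ring over itself carry different
    uniform structures, so that the notions of derivative are not convertible;
    the product and chain rules want the second one. *)
Lemma is_derive_AbsRing (f : C -> C) (z d : C) :
  @is_derive C_AbsRing C_NormedModule f z d <->
  @is_derive C_AbsRing (AbsRing_NormedModule C_AbsRing) f z d.
Proof.
  split; intros [_ H]; (split; [apply is_linear_scal_l | exact H]).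
Qed.

Lemma Cdifferentiable_mult (f g : C -> C) (z : C) :
  Cdifferentiable f z -> Cdifferentiable g z ->
  Cdifferentiable (fun y => f y * g y) z.
Proof.
  intros [df Hf] [dg Hg]; eexists; apply is_derive_AbsRing.
  exact (is_derive_mult (K := C_AbsRing) f g z df dg
    (proj1 (is_derive_AbsRing _ _ _) Hf) (proj1 (is_derive_AbsRing _ _ _) Hg)
    Cmult_comm).
Qed.

Lemma Cdifferentiable_comp (f g : C -> C) (z : C) :
  Cdifferentiable f (g z) -> Cdifferentiable g z ->
  Cdifferentiable (fun y => f (g y)) z.
Proof.
  intros [df Hf] [dg Hg]; eexists.
  exact (is_derive_comp (K := C_AbsRing) (V := C_NormedModule) f g z df dg Hf
    (proj1 (is_derive_AbsRing _ _ _) Hg)).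
Qed.

Lemma is_derive_affine (a b z : C) :
  @is_derive C_AbsRing C_NormedModule (fun y => a * y + b) z a.
Proof.
  apply is_derive_Cmod; intros eps Heps; exists 1%R; split; [lra |].
  intros h _; replace (a * (z + h) + b - (a * z + b) - h * a) with (RtoC 0) by ring.
  rewrite Cmod_0; apply Rmult_le_pos; [lra | apply Cmod_ge_0].
Qed.

Lemma Cdifferentiable_continuous (f : C -> C) (z : C) :
  Cdifferentiable f z ->
  forall eps : R, (0 < eps)%R -> locally z (fun y => (Cmod (f y - f z) < eps)%R).
Proof.
  intros H eps Heps; apply locally_C.
  apply (ex_derive_continuous (K := C_AbsRing) (V := C_NormedModule) f z H
    (fun y => (Cmod (y - f z) < eps)%R)).
  apply locally_Cmod; exists eps; auto.
Qed.

(** If f z = w, the first-order term dominates near z; otherwise continuity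
    suffices. *)
Lemma locally'_neq (f : C -> C) (z d w : C) :
  @is_derive C_AbsRing C_NormedModule f z d -> d <> 0 ->
  locally' z (fun y => f y <> w).
Proof.
  intros Hf Hd.
  destruct (Ceq_dec (f z) w) as [E | E].
  - apply Cmod_gt_0 in Hd.
    destruct (proj1 (is_derive_Cmod f z d) Hf (Cmod d / 2)%R) as [delta [Hdelta H]];
      [lra |].
    apply locally_Cmod; exists delta; split; [exact Hdelta |].
    intros y Hy Hyz Ey.
    specialize (H (y - z) Hy).
    replace (z + (y - z)) with y in H by ring.
    rewrite Ey, E in H.
    replace (w - w - (y - z) * d) with (- ((y - z) * d)) in H by ring.
    rewrite Cmod_opp, Cmod_mult in H.
    assert (0 < Cmod (y - z))%R.
    { apply Cmod_gt_0; intros E0; apply Hyz.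
      replace y with (y - z + z) by ring; rewrite E0; apply Cplus_0_l. }
    nra.
  - assert (0 < Cmod (f z - w))%R.
    { apply Cmod_gt_0; intros E0; apply E.
      replace (f z) with (f z - w + w) by ring; rewrite E0; ring. }
    assert (Hc : locally z (fun y => (Cmod (f y - f z) < Cmod (f z - w))%R)).
    { apply Cdifferentiable_continuous; [exists d; exact Hf | assumption]. }
    apply filter_imp with (2 := Hc).
    intros y Hy _ Ey; rewrite Ey in Hy.
    replace (w - f z) with (- (f z - w)) in Hy by ring.
    rewrite Cmod_opp in Hy; lra.
Qed.

(** The uniform quadratic bound makes the difference quotients of all f t, for
    one small fixed increment, uniformly close to the derivatives d t; pointwise
    convergence at two points then makes the derivatives Cauchy, and the bound
    itself is inherited by the limit. *)
Lemma Cdifferentiable_lim {T : Type} (F : (T -> Prop) -> Prop) {FF : ProperFilter F}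
    (f : T -> C -> C) (d : T -> C) (g : C -> C) (z : C) (K : R) :
  (forall y, filterlim (fun t => f t y) F (locally (g y))) ->
  (forall t h, (Cmod h <= 1)%R ->
     (Cmod (f t (z + h)%C - f t z - h * d t) <= K * (Cmod h) ^ 2)%R) ->
  Cdifferentiable g z.
Proof.
  intros Hlim Hd.
  assert (HK : (0 <= K)%R).
  { destruct (filter_ex _ (filter_true (F := F))) as [t _].
    specialize (Hd t 1); rewrite Cmod_1 in Hd.
    specialize (Hd (Rle_refl 1)).
    pose proof (Cmod_ge_0 (f t (z + 1) - f t z - 1 * d t)); lra. }
  pose proof (fun y => proj1 (filterlim_Cmod F _ _) (Hlim y)) as Hlim'.
  assert (He : filterlim d F (locally (Clim F d))).
  { apply (Clim_cauchy F d); intros eps Heps.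
    (* With this increment the Taylor remainder costs at most half of eps. *)
    set (eta := Rmin 1 (eps / (2 * (K + 1)))).
    assert (Heta : (0 < eta)%R).
    { apply Rmin_pos; [lra | apply Rdiv_lt_0_compat; lra]. }
    assert (Heta1 : (eta <= 1)%R) by apply Rmin_l.
    assert (HetaK : (K * eta <= eps / 2)%R).
    { apply Rle_trans with ((K + 1) * (eps / (2 * (K + 1))))%R.
      - apply Rmult_le_compat; try lra; apply Rmin_r.
      - right; field; lra. }
    assert (Hm : Cmod eta = eta) by (rewrite Cmod_R; apply Rabs_pos_eq; lra).
    assert (Hne : RtoC eta <> 0).
    { intros E; rewrite E, Cmod_0 in Hm; lra. }
    (* The difference quotient of the limit is what the d t are close to. *)
    exists ((g (z + eta) - g z) / eta).
    assert (H4 : (0 < eta * (eps / 4))%R) by (apply Rmult_lt_0_compat; lra).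
    apply filter_imp with (2 := filter_and _ _
      (Hlim' (z + eta) _ H4) (Hlim' z _ H4)).
    intros t [H1 H2].
    assert (H3 := Hd t eta ltac:(lra)); rewrite Hm in H3.
    apply Rmult_lt_reg_l with eta; [exact Heta |].
    rewrite <- Hm at 1; rewrite <- Cmod_mult.
    replace (eta * (d t - (g (z + eta) - g z) / eta)) with
      (- (f t (z + eta) - f t z - eta * d t)
       + ((f t (z + eta) - g (z + eta)) + - (f t z - g z))) by (field; exact Hne).
    eapply Rle_lt_trans; [apply Cmod_triangle |].
    rewrite Cmod_opp.
    pose proof (Cmod_triangle (f t (z + eta) - g (z + eta)) (- (f t z - g z))) as H5.
    rewrite Cmod_opp in H5.
    assert (K * eta ^ 2 <= eta * (eps / 2))%R by nra.
    lra. }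
  assert (Hq : forall h, (Cmod h <= 1)%R ->
    (Cmod (g (z + h)%C - g z - h * Clim F d) <= K * (Cmod h) ^ 2)%R).
  { intros h Hh; apply le_epsilon; intros eps Heps.
    assert (H3 : (0 < eps / 3)%R) by lra.
    destruct (filter_ex _ (filter_and _ _ (filter_and _ _
      (Hlim' (z + h) _ H3) (Hlim' z _ H3))
      (proj1 (filterlim_Cmod F _ _) He _ H3))) as [t [[H4 H5] H6]].
    specialize (Hd t h Hh).
    replace (g (z + h)%C - g z - h * Clim F d) with
      ((f t (z + h)%C - f t z - h * d t) +
       (- (f t (z + h)%C - g (z + h)) + ((f t z - g z) + h * (d t - Clim F d))))
      by ring.
    eapply Rle_trans; [apply Cmod_triangle |].
    apply Rplus_le_compat; [exact Hd |].
    eapply Rle_trans; [apply Cmod_triangle |]; rewrite Cmod_opp.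
    pose proof (Cmod_triangle (f t z - g z) (h * (d t - Clim F d))) as H7.
    rewrite Cmod_mult in H7.
    pose proof (Cmod_ge_0 h); pose proof (Cmod_ge_0 (d t - Clim F d)).
    nra. }
  exists (Clim F d); apply is_derive_Cmod; intros eps Heps.
  exists (Rmin 1 (eps / (K + 1))); split.
  { apply Rmin_pos; [lra | apply Rdiv_lt_0_compat; lra]. }
  intros h Hh.
  assert (H1 : (Cmod h < 1)%R) by (eapply Rlt_le_trans; [exact Hh | apply Rmin_l]).
  assert (H2 : (Cmod h * (K + 1) < eps)%R).
  { apply Rlt_le_trans with (eps / (K + 1) * (K + 1))%R.
    - apply Rmult_lt_compat_r; [lra |].
      eapply Rlt_le_trans; [exact Hh | apply Rmin_r].
    - right; field; lra. }
  specialize (Hq h ltac:(lra)); pose proof (Cmod_ge_0 h); nra.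
Qed.

(** * The complex exponential *)

Lemma Cexp_plus (a b : C) : Cexp (a + b) = Cexp a * Cexp b.
Proof.
  unfold Cexp, Cmult; cbn [fst snd].
  replace (Re (a + b)) with (Re a + Re b)%R by reflexivity.
  replace (Im (a + b)) with (Im a + Im b)%R by reflexivity.
  rewrite exp_plus, cos_plus, sin_plus; f_equal; ring.
Qed.

Lemma Cexp_0 : Cexp 0 = 1.
Proof.
  unfold Cexp; cbn; rewrite exp_0, cos_0, sin_0; unfold RtoC; f_equal; ring.
Qed.

Lemma Cexp_neq_0 (z : C) : Cexp z <> 0.
Proof.
  intros E.
  assert (H : Cexp (z + - z) = 0) by (rewrite Cexp_plus, E; ring).
  replace (z + - z) with (RtoC 0) in H by ring.
  rewrite Cexp_0 in H; injection H; lra.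
Qed.

Lemma Cmod_Cexp (z : C) : Cmod (Cexp z) = exp (Re z).
Proof.
  unfold Cmod, Cexp; cbn [fst snd].
  replace ((exp (Re z) * cos (Im z)) ^ 2 + (exp (Re z) * sin (Im z)) ^ 2)%R
    with (exp (Re z) ^ 2 * (Rsqr (sin (Im z)) + Rsqr (cos (Im z))))%R
    by (unfold Rsqr; ring).
  rewrite sin2_cos2, Rmult_1_r, <- Rsqr_pow2.
  apply sqrt_Rsqr; left; apply exp_pos.
Qed.

Lemma derivable_pt_lim_bound (f : R -> R) (l : R) :
  derivable_pt_lim f 0 l ->
  forall eps : R, (0 < eps)%R -> exists delta : R, (0 < delta)%R /\
    forall h : R, (Rabs h < delta)%R -> (Rabs (f h - f 0 - l * h) <= eps * Rabs h)%R.
Proof.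
  intros H eps Heps; destruct (H eps Heps) as [delta Hd].
  exists delta; split; [apply cond_pos |]; intros h Hh.
  destruct (Req_dec h 0) as [-> | Hh0].
  - replace (f 0 - f 0 - l * 0)%R with 0%R by ring; rewrite Rabs_R0; lra.
  - specialize (Hd h Hh0 Hh); rewrite Rplus_0_l in Hd.
    replace (f h - f 0 - l * h)%R with (((f h - f 0) / h - l) * h)%R
      by (field; exact Hh0).
    rewrite Rabs_mult; apply Rmult_le_compat_r; [apply Rabs_pos | lra].
Qed.

(** By the addition formula it is enough to expand Cexp at 0, where the real and
    imaginary parts exp a cos b - 1 - a and exp a sin b - b are controlled by the
    real derivatives of exp, cos and sin at 0. *)
Lemma is_derive_Cexp (z : C) :
  @is_derive C_AbsRing C_NormedModule Cexp z (Cexp z).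
Proof.
  apply is_derive_Cmod; intros eps Heps.
  pose proof (Cmod_ge_0 (Cexp z)) as HM; set (M := Cmod (Cexp z)) in *.
  (* 9 = 4 + 5, from the bounds for the real and the imaginary part. *)
  set (e := Rmin 1 (eps / (9 * (M + 1)))).
  assert (He : (0 < e)%R).
  { apply Rmin_pos; [lra | apply Rdiv_lt_0_compat; lra]. }
  assert (He1 : (e <= 1)%R) by apply Rmin_l.
  assert (HeM : (M * (9 * e) <= eps)%R).
  { apply Rle_trans with ((M + 1) * (9 * (eps / (9 * (M + 1)))))%R.
    - apply Rmult_le_compat; try lra.
      apply Rmult_le_compat_l; [lra | apply Rmin_r].
    - right; field; lra. }
  destruct (derivable_pt_lim_bound exp 1 ltac:(rewrite <- exp_0; apply derivable_pt_lim_exp) e He)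
    as [d1 [Hd1 H1]].
  destruct (derivable_pt_lim_bound cos 0
    ltac:(replace 0%R with (- sin 0)%R at 2 by (rewrite sin_0; ring);
          apply derivable_pt_lim_cos) e He) as [d2 [Hd2 H2]].
  destruct (derivable_pt_lim_bound sin 1
    ltac:(rewrite <- cos_0; apply derivable_pt_lim_sin) e He) as [d3 [Hd3 H3]].
  exists (Rmin e (Rmin d1 (Rmin d2 d3))); split.
  { repeat (apply Rmin_pos; [assumption |]); assumption. }
  intros h Hh.
  rewrite Cexp_plus.
  replace (Cexp z * Cexp h - Cexp z - h * Cexp z) with (Cexp z * (Cexp h - 1 - h))
    by ring.
  rewrite Cmod_mult; fold M.
  assert (Hb : (Cmod (Cexp h - 1 - h) <= 9 * e * Cmod h)%R).
  { destruct h as [a b].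
    pose proof (Rmax_Cmod (a, b)) as Hab; cbn [fst snd] in Hab.
    assert (Ha : (Rabs a <= Cmod (a, b))%R)
      by (eapply Rle_trans; [apply Rmax_l | exact Hab]).
    assert (Hb : (Rabs b <= Cmod (a, b))%R)
      by (eapply Rle_trans; [apply Rmax_r | exact Hab]).
    pose proof (Rmin_l e (Rmin d1 (Rmin d2 d3))).
    pose proof (Rmin_r e (Rmin d1 (Rmin d2 d3))).
    pose proof (Rmin_l d1 (Rmin d2 d3)).
    pose proof (Rmin_r d1 (Rmin d2 d3)).
    pose proof (Rmin_l d2 d3). pose proof (Rmin_r d2 d3).
    specialize (H1 a ltac:(lra)); specialize (H2 b ltac:(lra));
      specialize (H3 b ltac:(lra)).
    rewrite exp_0 in H1; rewrite cos_0 in H2; rewrite sin_0 in H3.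
    set (m := Cmod (a, b)) in *.
    assert (Hea : (0 < exp a <= 3)%R).
    { split; [apply exp_pos |].
      apply Rle_trans with (exp 1); [| exact exp_le_3].
      left; apply exp_increasing.
      pose proof (Rle_abs a); lra. }
    assert (Hea1 : (Rabs (exp a - 1) <= 2 * Rabs a)%R).
    { replace (exp a - 1)%R with ((exp a - 1 - 1 * a) + a)%R by ring.
      eapply Rle_trans; [apply Rabs_triang |].
      pose proof (Rabs_pos a); nra. }
    assert (HR : (Rabs (exp a * cos b - 1 - a) <= 4 * e * m)%R).
    { replace (exp a * cos b - 1 - a)%R with
        (exp a * (cos b - 1 - 0 * b) + (exp a - 1 - 1 * a))%R by ring.
      eapply Rle_trans; [apply Rabs_triang |].
      rewrite Rabs_mult, (Rabs_pos_eq (exp a)) by lra.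
      pose proof (Rabs_pos a); pose proof (Rabs_pos b).
      pose proof (Rabs_pos (cos b - 1 - 0 * b)).
      assert (exp a * Rabs (cos b - 1 - 0 * b) <= 3 * (e * Rabs b))%R
        by (apply Rmult_le_compat; lra).
      nra. }
    assert (HI : (Rabs (exp a * sin b - 0 - b) <= 5 * e * m)%R).
    { replace (exp a * sin b - 0 - b)%R with
        (exp a * (sin b - 0 - 1 * b) + (exp a - 1) * b)%R by ring.
      eapply Rle_trans; [apply Rabs_triang |].
      rewrite !Rabs_mult, (Rabs_pos_eq (exp a)) by lra.
      pose proof (Rabs_pos a); pose proof (Rabs_pos b).
      pose proof (Rabs_pos (sin b - 0 - 1 * b)).
      assert (exp a * Rabs (sin b - 0 - 1 * b) <= 3 * (e * Rabs b))%R
        by (apply Rmult_le_compat; lra).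
      assert (Rabs (exp a - 1) * Rabs b <= (2 * e) * Rabs b)%R
        by (apply Rmult_le_compat_r; lra).
      nra. }
    replace (Cexp (a, b) - 1 - (a, b)) with
      (RtoC (exp a * cos b - 1 - a) + Ci * RtoC (exp a * sin b - 0 - b)).
    - eapply Rle_trans; [apply Cmod_triangle |].
      rewrite Cmod_mult, Cmod_Ci, !Cmod_R; lra.
    - apply injective_projections; cbn; ring. }
  pose proof (Cmod_ge_0 h).
  apply Rle_trans with (M * (9 * e * Cmod h))%R.
  - apply Rmult_le_compat_l; [exact HM | exact Hb].
  - nra.
Qed.

(** * Products over finite lists *)

Fixpoint lprod {A : Type} (f : A -> C) (l : list A) : C :=
  match l with
  | nil => 1
  | cons a m => f a * lprod f m
  end.

Fixpoint lsum {A : Type} (b : A -> R) (l : list A) : R :=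
  match l with
  | nil => 0%R
  | cons a m => (b a + lsum b m)%R
  end.

Lemma lprod_app {A : Type} (f : A -> C) (l m : list A) :
  lprod f (l ++ m) = lprod f l * lprod f m.
Proof.
  induction l as [| a l IH]; cbn [lprod lsum app]; [ring |].
  rewrite IH; ring.
Qed.

Lemma lsum_app {A : Type} (b : A -> R) (l m : list A) :
  lsum b (l ++ m) = (lsum b l + lsum b m)%R.
Proof.
  induction l as [| a l IH]; cbn [lprod lsum app]; [ring |].
  rewrite IH; ring.
Qed.

Lemma lprod_perm {A : Type} (f : A -> C) (l m : list A) :
  Permutation l m -> lprod f l = lprod f m.
Proof.
  induction 1; cbn [lprod lsum] in *; try congruence; try ring.
Qed.

Lemma lsum_perm {A : Type} (b : A -> R) (l m : list A) :
  Permutation l m -> lsum b l = lsum b m.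
Proof.
  induction 1; cbn [lprod lsum] in *; try congruence; try ring.
Qed.

Lemma lsum_pos {A : Type} (b : A -> R) (l : list A) :
  (forall a, 0 <= b a)%R -> (0 <= lsum b l)%R.
Proof.
  intros Hb; induction l as [| a l IH]; cbn [lprod lsum app]; [lra |].
  specialize (Hb a); lra.
Qed.

Lemma lsum_scal {A : Type} (b : A -> R) (X : R) (l : list A) :
  lsum (fun a => b a * X)%R l = (lsum b l * X)%R.
Proof.
  induction l as [| a l IH]; cbn [lprod lsum app]; [ring |].
  rewrite IH; ring.
Qed.

Lemma lprod_neq_0 {A : Type} (f : A -> C) (l : list A) :
  (forall a, In a l -> f a <> 0) -> lprod f l <> 0.
Proof.
  induction l as [| a l IH]; intros H; cbn [lprod lsum app].
  - intros E; injection E; lra.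
  - apply Cmult_neq_0; [apply H; left; reflexivity |].
    apply IH; intros b Hb; apply H; right; exact Hb.
Qed.

Lemma lprod_eq_0 {A : Type} (f : A -> C) (l : list A) (a : A) :
  In a l -> f a = 0 -> lprod f l = 0.
Proof.
  intros Ha Hf; induction l as [| b l IH]; cbn [lprod lsum app]; [destruct Ha |].
  destruct Ha as [-> | Ha]; [rewrite Hf; ring |].
  rewrite (IH Ha); ring.
Qed.

Lemma exp_step (b S : R) : ((1 + b) * exp S <= exp (b + S))%R.
Proof.
  rewrite exp_plus; apply Rmult_le_compat_r; [left; apply exp_pos |].
  apply exp_ineq1_le.
Qed.

(** The factor 1 + (f a - 1) is dominated by 1 + b a <= exp (b a). *)
Lemma lprod_sub1_le {A : Type} (f : A -> C) (b : A -> R) (l : list A) :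
  (forall a, Cmod (f a - 1) <= b a)%R ->
  (Cmod (lprod f l - 1) <= exp (lsum b l) - 1)%R.
Proof.
  intros H; induction l as [| a l IH].
  - cbn [lprod lsum app]; replace (1 - 1) with (RtoC 0) by ring; rewrite Cmod_0, exp_0; lra.
  - cbn [lprod lsum app]; replace (f a * lprod f l - 1) with
      ((f a - 1) * (lprod f l - 1) + ((f a - 1) + (lprod f l - 1))) by ring.
    pose proof (Cmod_triangle ((f a - 1) * (lprod f l - 1))
      ((f a - 1) + (lprod f l - 1))) as H1.
    pose proof (Cmod_triangle (f a - 1) (lprod f l - 1)) as H2.
    rewrite Cmod_mult in H1.
    specialize (H a); pose proof (exp_step (b a) (lsum b l)).
    pose proof (Cmod_ge_0 (f a - 1)); pose proof (Cmod_ge_0 (lprod f l - 1)).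
    assert (Cmod (f a - 1) * Cmod (lprod f l - 1) <= b a * (exp (lsum b l) - 1))%R
      by (apply Rmult_le_compat; assumption).
    lra.
Qed.

Lemma Cmod_lprod_le {A : Type} (f : A -> C) (b : A -> R) (l : list A) :
  (forall a, Cmod (f a - 1) <= b a)%R -> (Cmod (lprod f l) <= exp (lsum b l))%R.
Proof.
  intros H; pose proof (lprod_sub1_le f b l H) as H1.
  replace (lprod f l) with ((lprod f l - 1) + 1) by ring.
  pose proof (Cmod_triangle (lprod f l - 1) 1) as H2.
  rewrite Cmod_1 in H2; lra.
Qed.

(** The derivative at x of the product of 1 - c a x, by the product rule. *)
Fixpoint lprod_deriv {A : Type} (c : A -> C) (x : C) (l : list A) : C :=
  match l with
  | nil => 0
  | cons a m =>
      (1 - c a * x) * lprod_deriv c x m - c a * lprod (fun i => 1 - c i * x) m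
  end.

(** Value, increment and Taylor remainder of the product are bounded together,
    because each of them needs the previous one in the induction on l. The bounds
    depend on l only through S, so they are uniform over all finite
    subproducts of an absolutely convergent product. *)
Lemma lprod_taylor {A : Type} (c : A -> C) (x h : C) (X : R) (l : list A) :
  (Cmod x <= X)%R -> (Cmod (x + h) <= X)%R ->
  let S := lsum (fun a => Cmod (c a)) l in
  let P y := lprod (fun a => 1 - c a * y) l in
  (Cmod (P (x + h)%C) <= exp (S * X) /\
   Cmod (P (x + h)%C - P x) <= Cmod h * (S * exp (S * X)) /\
   Cmod (P (x + h)%C - P x - h * lprod_deriv c x l)
     <= Cmod h ^ 2 * (S ^ 2 * exp (S * X)))%R.
Proof.
  intros Hx Hxh; induction l as [| a l IH]; cbn zeta.
  - cbn [lprod lsum lprod_deriv]; replace (1 - 1) with (RtoC 0) by ring.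
    replace (0 - h * 0) with (RtoC 0) by ring.
    rewrite Cmod_0, Cmod_1, Rmult_0_l, exp_0; lra.
  - cbn zeta in IH; cbn [lprod lsum lprod_deriv].
    set (S := lsum (fun i => Cmod (c i)) l) in *.
    set (P1 := lprod (fun i => 1 - c i * (x + h)) l) in *.
    set (P0 := lprod (fun i => 1 - c i * x) l) in *.
    set (d := lprod_deriv c x l) in *.
    destruct IH as [IH0 [IH1 IH2]].
    assert (HS : (0 <= S)%R) by (apply lsum_pos; intros; apply Cmod_ge_0).
    pose proof (Cmod_ge_0 (c a)) as Hc; pose proof (Cmod_ge_0 h) as Hh.
    pose proof (Cmod_ge_0 x) as Hx0.
    pose proof (exp_step (Cmod (c a) * X) (S * X)) as He.
    replace (Cmod (c a) * X + S * X)%R with ((Cmod (c a) + S) * X)%R in He by ring.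
    set (E := exp (S * X)) in *; set (E' := exp ((Cmod (c a) + S) * X)) in *.
    assert (HE : (0 < E)%R) by apply exp_pos.
    assert (HcX : (0 <= Cmod (c a) * X)%R) by (apply Rmult_le_pos; lra).
    assert (HEE : (E <= E')%R) by nra.
    assert (Hf : forall y, (Cmod y <= X)%R -> (Cmod (1 - c a * y) <= 1 + Cmod (c a) * X)%R).
    { intros y Hy; unfold Cminus.
      eapply Rle_trans; [apply Cmod_triangle |].
      rewrite Cmod_1, Cmod_opp, Cmod_mult.
      apply Rplus_le_compat_l, Rmult_le_compat_l; assumption. }
    (* Multiplying by one more factor turns a bound B * E into B * E'. *)
    assert (Hgrow : forall y w B, (Cmod y <= X)%R -> (0 <= B)%R ->
      (Cmod w <= B * E)%R -> (Cmod ((1 - c a * y) * w) <= B * E')%R).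
    { intros y w B Hy HB Hw; rewrite Cmod_mult.
      apply Rle_trans with ((1 + Cmod (c a) * X) * (B * E))%R.
      - apply Rmult_le_compat; auto using Cmod_ge_0.
      - replace ((1 + Cmod (c a) * X) * (B * E))%R with
          (B * ((1 + Cmod (c a) * X) * E))%R by ring.
        apply Rmult_le_compat_l; assumption. }
    assert (HhS : (0 <= Cmod h * S)%R) by (apply Rmult_le_pos; assumption).
    assert (Hhc : (0 <= Cmod h * Cmod (c a))%R) by (apply Rmult_le_pos; assumption).
    split; [| split].
    + rewrite <- (Rmult_1_l E'); apply Hgrow; lra.
    + replace ((1 - c a * (x + h)) * P1 - (1 - c a * x) * P0) with
        ((1 - c a * x) * (P1 - P0) + - (h * c a * P1)) by ring.
      eapply Rle_trans; [apply Cmod_triangle |].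
      rewrite Cmod_opp, (Cmod_mult (h * c a)), (Cmod_mult h).
      assert (Cmod ((1 - c a * x) * (P1 - P0)) <= Cmod h * S * E')%R
        by (apply Hgrow; lra).
      assert (Cmod h * Cmod (c a) * Cmod P1 <= Cmod h * Cmod (c a) * E')%R
        by (apply Rmult_le_compat_l; lra).
      lra.
    + replace ((1 - c a * (x + h)) * P1 - (1 - c a * x) * P0
               - h * ((1 - c a * x) * d - c a * P0)) with
        ((1 - c a * x) * (P1 - P0 - h * d) + - (h * c a * (P1 - P0))) by ring.
      eapply Rle_trans; [apply Cmod_triangle |].
      rewrite Cmod_opp, (Cmod_mult (h * c a)), (Cmod_mult h (c a)).
      assert (Cmod ((1 - c a * x) * (P1 - P0 - h * d)) <= (Cmod h * S) ^ 2 * E')%R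
        by (apply Hgrow; [lra | apply pow2_ge_0 | lra]).
      assert (Cmod h * Cmod (c a) * Cmod (P1 - P0)
              <= Cmod h * Cmod (c a) * (Cmod h * S * E'))%R.
      { apply Rmult_le_compat_l; [assumption |].
        eapply Rle_trans; [exact IH1 |].
        rewrite <- Rmult_assoc; apply Rmult_le_compat_l; assumption. }
      assert (0 <= Cmod h * Cmod (c a) * (Cmod h * Cmod (c a)) * E')%R
        by (repeat apply Rmult_le_pos; lra).
      assert (0 <= Cmod h * Cmod (c a) * (Cmod h * S) * E')%R
        by (repeat apply Rmult_le_pos; lra).
      lra.
Qed.

(** * Infinite products over an exhausting family of finite lists *)

(** The initial segments of nat and the rectangles of nat * nat are the two
    cases of interest; the common notion lets one argument treat simple and double
    infinite products. *)
Definition exhausting {I A : Type} (F : (I -> Prop) -> Prop) (L : I -> list A) :=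
  (forall i, NoDup (L i)) /\ (forall i, F (fun k => incl (L i) (L k))).

Lemma NoDup_incl_rest {A : Type} (l m : list A) :
  NoDup l -> incl l m -> exists rest, Permutation m (l ++ rest).
Proof.
  intros Hl; revert m; induction Hl as [| a l Ha Hl IH]; intros m Hm.
  - exists m; reflexivity.
  - destruct (in_split a m (Hm a (or_introl eq_refl))) as [m1 [m2 ->]].
    destruct (IH (m1 ++ m2)) as [rest Hr].
    + intros b Hb.
      specialize (Hm b (or_intror Hb)); rewrite in_app_iff in *; cbn in Hm.
      destruct Hm as [Hm | [<- | Hm]]; tauto.
    + exists rest; cbn; rewrite <- Hr; symmetry; apply Permutation_middle.
Qed.

(** The sums over the L i have a supremum; once L i0 comes within eps of it,
    nothing that is added to L i0 later can contribute more than eps. *)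
Lemma exhausting_tail {I A : Type} (F : (I -> Prop) -> Prop) {FF : ProperFilter F}
    (L : I -> list A) (b : A -> R) (B eps : R) :
  exhausting F L -> (forall i, lsum b (L i) <= B)%R -> (0 < eps)%R ->
  exists i0, F (fun i => exists rest,
    Permutation (L i) (L i0 ++ rest) /\ (lsum b rest <= eps)%R).
Proof.
  intros [Hnd Hinc] HB Heps.
  destruct (filter_ex _ (filter_true (F := F))) as [i1 _].
  destruct (completeness (fun s => exists i, s = lsum b (L i))) as [S [HS1 HS2]].
  - exists B; intros s [i ->]; apply HB.
  - exists (lsum b (L i1)), i1; reflexivity.
  - assert (Hi0 : exists i0, (S - eps < lsum b (L i0))%R).
    { apply Classical_Prop.NNPP; intros Hn.
      assert (S <= S - eps)%R; [| lra].
      apply HS2; intros s [i ->]; apply Rnot_lt_le; intros Hi; apply Hn.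
      exists i; exact Hi. }
    destruct Hi0 as [i0 Hi0]; exists i0.
    apply filter_imp with (2 := Hinc i0); intros i Hi.
    destruct (NoDup_incl_rest _ _ (Hnd i0) Hi) as [rest Hr].
    exists rest; split; [exact Hr |].
    assert (H1 : (lsum b (L i) <= S)%R) by (apply HS1; exists i; reflexivity).
    rewrite (lsum_perm b _ _ Hr), lsum_app in H1; lra.
Qed.

(** From exp (- t) >= 1 - t. *)
Lemma exp_sub1_le (t : R) : (0 <= t <= 1 / 2)%R -> (exp t - 1 <= 2 * t)%R.
Proof.
  intros Ht.
  pose proof (exp_ineq1_le (- t)) as H1; rewrite exp_Ropp in H1.
  pose proof (exp_pos t) as H2.
  assert (H3 : ((1 - t) * exp t <= 1)%R).
  { replace 1%R with (/ exp t * exp t)%R at 2 by (field; lra).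
    apply Rmult_le_compat_r; lra. }
  nra.
Qed.

(** The index i0 is chosen before f: this uniformity is what makes it possible to
    decide the vanishing of an infinite product, for all arguments in a disc at
    once, on finitely many of its factors. *)
Lemma lprod_tail {I A : Type} (F : (I -> Prop) -> Prop) {FF : ProperFilter F}
    (L : I -> list A) (b : A -> R) (B eps : R) :
  exhausting F L -> (forall a, 0 <= b a)%R -> (forall i, lsum b (L i) <= B)%R ->
  (0 < eps)%R ->
  exists i0, forall f, (forall a, Cmod (f a - 1) <= b a)%R ->
    F (fun i => (Cmod (lprod f (L i) - lprod f (L i0))
                   <= eps * Cmod (lprod f (L i0)))%R).
Proof.
  intros HL Hb HB Heps.
  set (t := Rmin (1 / 2) (eps / 2)).
  assert (Ht : (0 < t)%R) by (apply Rmin_pos; lra).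
  assert (Ht1 : (t <= 1 / 2)%R) by apply Rmin_l.
  assert (Ht2 : (t <= eps / 2)%R) by apply Rmin_r.
  destruct (exhausting_tail F L b B t HL HB Ht) as [i0 Hi0].
  exists i0; intros f Hf.
  apply filter_imp with (2 := Hi0); intros i [rest [Hr Hs]].
  rewrite (lprod_perm f _ _ Hr), lprod_app.
  replace (lprod f (L i0) * lprod f rest - lprod f (L i0)) with
    ((lprod f rest - 1) * lprod f (L i0)) by ring.
  rewrite Cmod_mult; apply Rmult_le_compat_r; [apply Cmod_ge_0 |].
  pose proof (lprod_sub1_le f b rest Hf).
  pose proof (lsum_pos b rest Hb).
  pose proof (exp_sub1_le (lsum b rest) ltac:(lra)); lra.
Qed.

Lemma lprod_lim {I A : Type} (F : (I -> Prop) -> Prop) {FF : ProperFilter F}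
    (L : I -> list A) (b : A -> R) (B : R) (f : A -> C) :
  exhausting F L -> (forall a, Cmod (f a - 1) <= b a)%R ->
  (forall i, lsum b (L i) <= B)%R ->
  filterlim (fun i => lprod f (L i)) F
    (locally (Clim F (fun i => lprod f (L i)))).
Proof.
  intros HL Hf HB.
  apply (Clim_cauchy F (fun i => lprod f (L i))); intros eps Heps.
  assert (Hb : forall a, (0 <= b a)%R)
    by (intros a; eapply Rle_trans; [apply Cmod_ge_0 | apply Hf]).
  pose proof (exp_pos B) as HE.
  destruct (lprod_tail F L b B (eps / (2 * exp B))%R HL Hb HB) as [i0 Hi0];
    [apply Rdiv_lt_0_compat; lra |].
  exists (lprod f (L i0)); apply filter_imp with (2 := Hi0 f Hf).
  intros i Hi; eapply Rle_lt_trans; [exact Hi |].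
  assert (H1 : (Cmod (lprod f (L i0)) <= exp B)%R).
  { eapply Rle_trans; [apply Cmod_lprod_le, Hf |].
    destruct (HB i0) as [H | ->]; [left; apply exp_increasing, H | right; reflexivity]. }
  apply Rle_lt_trans with (eps / (2 * exp B) * exp B)%R.
  - apply Rmult_le_compat_l; [| exact H1].
    left; apply Rdiv_lt_0_compat; lra.
  - replace (eps / (2 * exp B) * exp B)%R with (eps / 2)%R by (field; lra); lra.
Qed.

(** With i0 as in [lprod_tail] for eps = 1/2, the limit is closer to the partial
    product at i0 than 0 is. *)
Lemma lprod_lim_neq_0 {I A : Type} (F : (I -> Prop) -> Prop) {FF : ProperFilter F}
    (L : I -> list A) (b : A -> R) (B : R) :
  exhausting F L -> (forall a, 0 <= b a)%R -> (forall i, lsum b (L i) <= B)%R ->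
  exists i0, forall f, (forall a, Cmod (f a - 1) <= b a)%R ->
    lprod f (L i0) <> 0 -> Clim F (fun i => lprod f (L i)) <> 0.
Proof.
  intros HL Hb HB.
  destruct (lprod_tail F L b B (1 / 2)%R HL Hb HB) as [i0 Hi0]; [lra |].
  exists i0; intros f Hf Hn E.
  pose proof (Cmod_le_lim F _ _ _ _ (lprod_lim F L b B f HL Hf HB) (Hi0 f Hf)) as H.
  rewrite E in H.
  replace (0 - lprod f (L i0)) with (- lprod f (L i0)) in H by ring.
  rewrite Cmod_opp in H; apply Cmod_gt_0 in Hn; lra.
Qed.

Lemma lprod_lim_eq_0 {I A : Type} (F : (I -> Prop) -> Prop) {FF : ProperFilter F}
    (L : I -> list A) (f : A -> C) (i : I) (a : A) :
  exhausting F L -> In a (L i) -> f a = 0 -> Clim F (fun i => lprod f (L i)) = 0.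
Proof.
  intros [_ HL] Ha Hf; apply Clim_eq; [exact FF |].
  apply filterlim_Cmod; [apply FF |]; intros eps Heps.
  apply filter_imp with (2 := HL i); intros k Hk.
  rewrite (lprod_eq_0 f (L k) a (Hk a Ha) Hf).
  replace (0 - 0) with (RtoC 0) by ring; rewrite Cmod_0; exact Heps.
Qed.

Lemma lprod_lim_entire {I A : Type} (F : (I -> Prop) -> Prop) {FF : ProperFilter F}
    (L : I -> list A) (c : A -> C) (B : R) (z : C) :
  exhausting F L -> (forall i, lsum (fun a => Cmod (c a)) (L i) <= B)%R ->
  Cdifferentiable (fun x => Clim F (fun i => lprod (fun a => 1 - c a * x) (L i))) z.
Proof.
  intros HL HB.
  set (X := (Cmod z + 1)%R).
  apply (Cdifferentiable_lim F (fun i x => lprod (fun a => 1 - c a * x) (L i))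
    (fun i => lprod_deriv c z (L i)) _ z (B ^ 2 * exp (B * X))%R).
  - intros x.
    apply (lprod_lim F L (fun a => Cmod (c a) * Cmod x)%R (B * Cmod x)%R).
    + exact HL.
    + intros a; replace (1 - c a * x - 1) with (- (c a * x)) by ring.
      rewrite Cmod_opp, Cmod_mult; right; reflexivity.
    + intros i; rewrite lsum_scal; apply Rmult_le_compat_r; [apply Cmod_ge_0 | apply HB].
  - intros i h Hh.
    pose proof (Cmod_ge_0 z) as Hz.
    assert (HX : (Cmod (z + h) <= X)%R).
    { eapply Rle_trans; [apply Cmod_triangle |]; unfold X; lra. }
    destruct (lprod_taylor c z h X (L i) ltac:(unfold X; lra) HX) as [_ [_ H]].
    eapply Rle_trans; [exact H |].
    rewrite (Rmult_comm _ (Cmod h ^ 2)).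
    apply Rmult_le_compat_l; [apply pow2_ge_0 |].
    assert (HS : (0 <= lsum (fun a => Cmod (c a)) (L i))%R)
      by (apply lsum_pos; intros; apply Cmod_ge_0).
    specialize (HB i).
    apply Rmult_le_compat; [apply pow2_ge_0 | left; apply exp_pos | |].
    + apply pow_incr; lra.
    + assert (Hm : (lsum (fun a => Cmod (c a)) (L i) * X <= B * X)%R)
        by (apply Rmult_le_compat_r; unfold X; lra).
      destruct Hm as [Hm | ->]; [left; apply exp_increasing, Hm | right; reflexivity].
Qed.

(** * Finite products indexed by an initial segment *)

Lemma Cprod_ext (f g : nat -> C) (n : nat) :
  (forall i, (i < n)%nat -> f i = g i) -> Cprod f n = Cprod g n.
Proof.
  induction n as [| n IH]; intros H; cbn [Cprod]; [reflexivity |].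
  rewrite IH by auto; rewrite H by lia; reflexivity.
Qed.

Lemma Cprod_mult (f g : nat -> C) (n : nat) :
  Cprod (fun i => f i * g i) n = Cprod f n * Cprod g n.
Proof. induction n as [| n IH]; cbn [Cprod]; [| rewrite IH]; ring. Qed.

Lemma Cprod_neq_0 (f : nat -> C) (n : nat) :
  Cprod f n <> 0 <-> forall i, (i < n)%nat -> f i <> 0.
Proof.
  induction n as [| n IH]; cbn [Cprod].
  - split; [lia | intros _ E; injection E; lra].
  - split.
    + intros H i Hi E; apply H.
      destruct (Nat.eq_dec i n) as [-> | Hn]; [rewrite E; ring |].
      destruct (Ceq_dec (Cprod f n) 0) as [E0 | E0]; [rewrite E0; ring |].
      destruct (proj1 IH E0 i ltac:(lia) E).
    + intros H; apply Cmult_neq_0; [apply IH; auto | apply H; lia].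
Qed.

Lemma Cprod_inv (f : nat -> C) (n : nat) :
  (forall i, (i < n)%nat -> f i <> 0) -> Cprod (fun i => / f i) n = / Cprod f n.
Proof.
  induction n as [| n IH]; intros H; cbn [Cprod].
  - field; intros E; injection E; lra.
  - rewrite IH by auto; field; split; [apply H; lia | apply Cprod_neq_0; auto].
Qed.

Lemma Cprod_S_l (f : nat -> C) (n : nat) :
  Cprod f (S n) = f O * Cprod (fun i => f (S i)) n.
Proof.
  induction n as [| n IH]; [cbn [Cprod]; ring |].
  change (Cprod f (S (S n))) with (Cprod f (S n) * f (S n)).
  rewrite IH; cbn [Cprod]; ring.
Qed.

Lemma Cprod_rev (f : nat -> C) (n : nat) :
  Cprod (fun i => f (n - 1 - i)%nat) n = Cprod f n.
Proof.
  induction n as [| n IH]; [reflexivity |].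
  rewrite Cprod_S_l; cbn [Cprod]; rewrite <- IH.
  replace (S n - 1 - 0)%nat with n by lia.
  rewrite Cmult_comm; f_equal; apply Cprod_ext; intros i Hi; f_equal; lia.
Qed.

Lemma Cprod_1 (n : nat) : Cprod (fun _ => 1) n = 1.
Proof. induction n as [| n IH]; cbn [Cprod]; [| rewrite IH]; ring. Qed.

Lemma Cprod_exchange (f : nat -> nat -> C) (m n : nat) :
  Cprod (fun j => Cprod (f j) n) m = Cprod (fun k => Cprod (fun j => f j k) m) n.
Proof.
  induction m as [| m IH]; cbn [Cprod].
  - symmetry; apply Cprod_1.
  - rewrite IH, <- Cprod_mult; reflexivity.
Qed.

Lemma Cprod_add (f : nat -> C) (m n : nat) :
  Cprod f (m + n) = Cprod f m * Cprod (fun k => f (m + k)%nat) n.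
Proof.
  induction n as [| n IH].
  - rewrite Nat.add_0_r; cbn [Cprod]; ring.
  - rewrite Nat.add_succ_r; cbn [Cprod]; rewrite IH; ring.
Qed.

Lemma Cprod_blocks (f : nat -> C) (n M : nat) :
  Cprod f (n * M) = Cprod (fun j => Cprod (fun k => f (n * j + k)%nat) n) M.
Proof.
  induction M as [| M IH]; [rewrite Nat.mul_0_r; reflexivity |].
  rewrite Nat.mul_succ_r, Cprod_add, IH; reflexivity.
Qed.

Lemma filterlim_Cprod {T : Type} (F : (T -> Prop) -> Prop) {FF : Filter F}
    (f : nat -> T -> C) (l : nat -> C) (n : nat) :
  (forall i, (i < n)%nat -> filterlim (f i) F (locally (l i))) ->
  filterlim (fun t => Cprod (fun i => f i t) n) F (locally (Cprod l n)).
Proof.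
  induction n as [| n IH]; intros H; cbn [Cprod].
  - apply filterlim_const.
  - apply (filterlim_Cmult F); auto.
Qed.

(** Near l, |f t| > |l| / 2, so |1 / f t - 1 / l| is at most
    2 |f t - l| / |l|^2. *)
Lemma filterlim_Cinv {T : Type} (F : (T -> Prop) -> Prop) {FF : Filter F}
    (f : T -> C) (l : C) :
  l <> 0 -> filterlim f F (locally l) ->
  filterlim (fun t => / f t) F (locally (/ l)).
Proof.
  intros Hl Hf; apply (filterlim_Cmod F); intros eps Heps.
  pose proof (proj1 (Cmod_gt_0 l) Hl) as Hl0.
  set (d := Rmin (Cmod l / 2) (eps * (Cmod l) ^ 2 / 2)).
  assert (Hd : (0 < d)%R).
  { apply Rmin_pos; [lra |].
    pose proof (pow_lt (Cmod l) 2 Hl0).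
    apply Rdiv_lt_0_compat; [apply Rmult_lt_0_compat |]; lra. }
  apply filter_imp with (2 := proj1 (filterlim_Cmod F f l) Hf d Hd).
  intros t Ht.
  assert (H1 : (Cmod (f t - l) < Cmod l / 2)%R)
    by (eapply Rlt_le_trans; [exact Ht | apply Rmin_l]).
  assert (H2 : (Cmod (f t - l) < eps * (Cmod l) ^ 2 / 2)%R)
    by (eapply Rlt_le_trans; [exact Ht | apply Rmin_r]).
  assert (H3 : (Cmod l / 2 < Cmod (f t))%R).
  { pose proof (Cmod_triangle (f t) (- (f t - l))) as H.
    replace (f t + - (f t - l)) with l in H by ring.
    rewrite Cmod_opp in H; lra. }
  assert (Hft : f t <> 0) by (apply Cmod_gt_0; lra).
  replace (/ f t - / l) with (- (f t - l) / (f t * l)) by (field; auto).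
  rewrite Cmod_div by (apply Cmult_neq_0; assumption).
  rewrite Cmod_opp, Cmod_mult.
  apply Rmult_lt_reg_r with (Cmod (f t) * Cmod l)%R;
    [apply Rmult_lt_0_compat; lra |].
  replace (Cmod (f t - l) / (Cmod (f t) * Cmod l) * (Cmod (f t) * Cmod l))%R
    with (Cmod (f t - l)) by (field; lra).
  assert (eps * Cmod l * (Cmod l / 2) < eps * Cmod l * Cmod (f t))%R
    by (apply Rmult_lt_compat_l; [apply Rmult_lt_0_compat |]; lra).
  nra.
Qed.

(** * The q-Pochhammer symbols with one and with two bases *)

(** The double q-Pochhammer symbol (x; p, q). *)
Definition dpoch (p q x : C) : C := Cinfprod2 (fun j k => 1 - p ^ j * q ^ k * x).

Definition rect (MN : nat * nat) : list (nat * nat) :=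
  list_prod (seq 0 (fst MN)) (seq 0 (snd MN)).

Lemma Cprod_seq (f : nat -> C) (n : nat) : Cprod f n = lprod f (seq 0 n).
Proof.
  induction n as [| n IH]; [reflexivity |].
  rewrite seq_S, lprod_app, <- IH; cbn [Cprod lprod Nat.add]; ring.
Qed.

Lemma lprod_map {A B : Type} (f : B -> C) (g : A -> B) (l : list A) :
  lprod f (map g l) = lprod (fun a => f (g a)) l.
Proof.
  induction l as [| a l IH]; cbn [map lprod]; [| rewrite IH]; reflexivity.
Qed.

Lemma lsum_map {A B : Type} (f : B -> R) (g : A -> B) (l : list A) :
  lsum f (map g l) = lsum (fun a => f (g a)) l.
Proof.
  induction l as [| a l IH]; cbn [map lsum]; [| rewrite IH]; reflexivity.
Qed.

Lemma lprod_list_prod {A B : Type} (f : A * B -> C) (l : list A) (m : list B) :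
  lprod f (list_prod l m) = lprod (fun a => lprod (fun b => f (a, b)) m) l.
Proof.
  induction l as [| a l IH]; cbn [list_prod lprod]; [reflexivity |].
  rewrite lprod_app, IH, lprod_map; reflexivity.
Qed.

Lemma lsum_list_prod {A B : Type} (f : A -> R) (g : B -> R) (l : list A) (m : list B) :
  lsum (fun ab => f (fst ab) * g (snd ab))%R (list_prod l m) = (lsum f l * lsum g m)%R.
Proof.
  induction l as [| a l IH]; cbn [list_prod lsum]; [ring |].
  rewrite lsum_app, IH, lsum_map; cbn [fst snd].
  replace (lsum (fun b => f a * g b)%R m) with (f a * lsum g m)%R; [ring |].
  clear IH; induction m as [| b m IH]; cbn [lsum]; [| rewrite <- IH]; ring.
Qed.

Lemma Cprod_rect (f : nat -> nat -> C) (MN : nat * nat) :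
  Cprod (fun j => Cprod (f j) (snd MN)) (fst MN)
  = lprod (fun jk => f (fst jk) (snd jk)) (rect MN).
Proof.
  unfold rect; rewrite lprod_list_prod, <- Cprod_seq.
  apply Cprod_ext; intros j _; apply Cprod_seq.
Qed.

Lemma exhausting_seq : exhausting eventually (seq 0).
Proof.
  split; [intros n; apply seq_NoDup |].
  intros n; exists n; intros m Hm a; rewrite !in_seq; lia.
Qed.

Lemma NoDup_list_prod {A B : Type} (l : list A) (m : list B) :
  NoDup l -> NoDup m -> NoDup (list_prod l m).
Proof.
  intros Hl Hm; induction Hl as [| a l Ha Hl IH]; cbn [list_prod]; [constructor |].
  apply NoDup_app; [| exact IH |].
  - apply NoDup_map_NoDup_ForallPairs; [intros x y _ _ E; congruence | exact Hm].
  - intros [x y] H1 H2; apply in_map_iff in H1; destruct H1 as [b [E _]].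
    apply in_prod_iff in H2; apply Ha; replace a with x by congruence; apply H2.
Qed.

Lemma exhausting_rect : exhausting (filter_prod eventually eventually) rect.
Proof.
  split.
  - intros [M N]; apply NoDup_list_prod; apply seq_NoDup.
  - intros [M N]; exists (fun m => (M <= m)%nat) (fun m => (N <= m)%nat).
    + exists M; auto.
    + exists N; auto.
    + intros m n Hm Hn [j k]; unfold rect; cbn [fst snd].
      rewrite !in_prod_iff, !in_seq; lia.
Qed.

Lemma lsum_geom (s : R) (n : nat) :
  (0 <= s < 1)%R -> (0 <= lsum (pow s) (seq 0 n) <= / (1 - s))%R.
Proof.
  intros Hs; split; [apply lsum_pos; intros; apply pow_le; lra |].
  assert (H : (lsum (pow s) (seq 0 n) * (1 - s) = 1 - s ^ n)%R).
  { induction n as [| n IH]; [cbn; ring |].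
    rewrite seq_S, lsum_app, Rmult_plus_distr_r, IH; cbn [lsum Nat.add pow]; ring. }
  pose proof (pow_le s n (proj1 Hs)).
  apply Rmult_le_reg_r with (1 - s)%R; [lra |].
  rewrite Rinv_l, H; lra.
Qed.

Lemma lsum_rect_le (p q : C) (MN : nat * nat) :
  (Cmod p < 1)%R -> (Cmod q < 1)%R ->
  (lsum (fun jk => Cmod (p ^ fst jk * q ^ snd jk)) (rect MN)
   <= / (1 - Cmod p) * / (1 - Cmod q))%R.
Proof.
  intros Hp Hq; pose proof (Cmod_ge_0 p); pose proof (Cmod_ge_0 q).
  replace (lsum (fun jk => Cmod (p ^ fst jk * q ^ snd jk)) (rect MN)) with
    (lsum (fun jk => Cmod p ^ fst jk * Cmod q ^ snd jk)%R (rect MN)).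
  - unfold rect; rewrite (lsum_list_prod (pow (Cmod p)) (pow (Cmod q))).
    apply Rmult_le_compat; apply lsum_geom; lra.
  - generalize (rect MN); intros l; induction l as [| a l IH]; cbn [lsum]; [reflexivity |].
    rewrite IH, Cmod_mult, !Cmod_pow; reflexivity.
Qed.

Lemma dpoch_lprod (p q x : C) :
  dpoch p q x = Clim (filter_prod eventually eventually)
    (fun MN => lprod (fun jk => 1 - p ^ fst jk * q ^ snd jk * x) (rect MN)).
Proof.
  unfold dpoch, Cinfprod2; f_equal.
  apply FunctionalExtensionality.functional_extensionality; intros MN.
  apply (Cprod_rect (fun j k => 1 - p ^ j * q ^ k * x)).
Qed.

Lemma Cmod_factor_sub1 (c x : C) : Cmod (1 - c * x - 1) = (Cmod c * Cmod x)%R.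
Proof.
  replace (1 - c * x - 1) with (- (c * x)) by ring.
  rewrite Cmod_opp; apply Cmod_mult.
Qed.

Lemma dpoch_lim (p q x : C) :
  (Cmod p < 1)%R -> (Cmod q < 1)%R ->
  filterlim (fun MN : nat * nat =>
      Cprod (fun j => Cprod (fun k => 1 - p ^ j * q ^ k * x) (snd MN)) (fst MN))
    (filter_prod eventually eventually) (locally (dpoch p q x)).
Proof.
  intros Hp Hq; rewrite dpoch_lprod.
  eapply filterlim_ext;
    [intros MN; symmetry; apply (Cprod_rect (fun j k => 1 - p ^ j * q ^ k * x)) |].
  apply (lprod_lim _ rect
    (fun jk => Cmod (p ^ fst jk * q ^ snd jk) * Cmod x)%R
    (/ (1 - Cmod p) * / (1 - Cmod q) * Cmod x)%R).
  - apply exhausting_rect.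
  - intros jk; right; apply Cmod_factor_sub1.
  - intros MN; rewrite lsum_scal.
    apply Rmult_le_compat_r; [apply Cmod_ge_0 | apply lsum_rect_le; assumption].
Qed.

Lemma dpoch_entire (p q z : C) :
  (Cmod p < 1)%R -> (Cmod q < 1)%R -> Cdifferentiable (dpoch p q) z.
Proof.
  intros Hp Hq.
  eapply Cdifferentiable_ext; [intros x; symmetry; apply dpoch_lprod |].
  apply (lprod_lim_entire _ rect (fun jk => p ^ fst jk * q ^ snd jk)
    (/ (1 - Cmod p) * / (1 - Cmod q))%R).
  - apply exhausting_rect.
  - intros MN; apply lsum_rect_le; assumption.
Qed.

Lemma dpoch_factor_neq_0 (p q x : C) (j k : nat) :
  dpoch p q x <> 0 -> 1 - p ^ j * q ^ k * x <> 0.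
Proof.
  intros H E; apply H; rewrite dpoch_lprod.
  apply (lprod_lim_eq_0 _ rect (fun jk => 1 - p ^ fst jk * q ^ snd jk * x)
    (S j, S k) (j, k)).
  - apply exhausting_rect.
  - unfold rect; rewrite in_prod_iff, !in_seq; cbn [fst snd]; lia.
  - exact E.
Qed.

(** In a disc, a zero of the double product is a zero of one of finitely many
    factors. *)
Lemma dpoch_neq_0_bounded (p q : C) (X : R) :
  (Cmod p < 1)%R -> (Cmod q < 1)%R -> (0 <= X)%R ->
  exists l : list (nat * nat), forall x, (Cmod x <= X)%R ->
    (forall jk, In jk l -> 1 - p ^ fst jk * q ^ snd jk * x <> 0) ->
    dpoch p q x <> 0.
Proof.
  intros Hp Hq HX.
  destruct (lprod_lim_neq_0 (filter_prod eventually eventually) rect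
    (fun jk => Cmod (p ^ fst jk * q ^ snd jk) * X)%R
    (/ (1 - Cmod p) * / (1 - Cmod q) * X)%R) as [MN H].
  - apply exhausting_rect.
  - intros jk; apply Rmult_le_pos; [apply Cmod_ge_0 | exact HX].
  - intros MN; rewrite lsum_scal.
    apply Rmult_le_compat_r; [exact HX | apply lsum_rect_le; assumption].
  - exists (rect MN); intros x Hx Hl; rewrite dpoch_lprod; apply H.
    + intros jk; rewrite Cmod_factor_sub1.
      apply Rmult_le_compat_l; [apply Cmod_ge_0 | exact Hx].
    + apply lprod_neq_0, Hl.
Qed.

Lemma pow_le_1 (s : R) (n : nat) : (0 <= s <= 1)%R -> (s ^ n <= 1)%R.
Proof. intros Hs; rewrite <- (pow1 n); apply pow_incr, Hs. Qed.

Lemma dpoch_neq_0 (p q x : C) :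
  (Cmod p < 1)%R -> (Cmod q < 1)%R -> (Cmod x < 1)%R -> dpoch p q x <> 0.
Proof.
  intros Hp Hq Hx.
  destruct (dpoch_neq_0_bounded p q 1 Hp Hq Rle_0_1) as [l Hl].
  apply Hl; [lra |]; intros [j k] _ E; cbn [fst snd] in E.
  assert (H : (Cmod (p ^ j * q ^ k * x) = 1)%R).
  { rewrite <- Cmod_1; f_equal.
    replace (p ^ j * q ^ k * x) with (1 - (1 - p ^ j * q ^ k * x)) by ring.
    rewrite E; ring. }
  rewrite !Cmod_mult, !Cmod_pow in H.
  pose proof (Cmod_ge_0 p); pose proof (Cmod_ge_0 q); pose proof (Cmod_ge_0 x).
  pose proof (pow_le_1 (Cmod p) j ltac:(lra)); pose proof (pow_le_1 (Cmod q) k ltac:(lra)).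
  pose proof (pow_le (Cmod p) j ltac:(lra)); pose proof (pow_le (Cmod q) k ltac:(lra)).
  assert (Cmod p ^ j * Cmod q ^ k <= 1 * 1)%R by (apply Rmult_le_compat; assumption).
  assert (Cmod p ^ j * Cmod q ^ k * Cmod x <= 1 * Cmod x)%R
    by (apply Rmult_le_compat_r; lra).
  lra.
Qed.

Lemma qpoch_lim (x q : C) :
  (Cmod q < 1)%R ->
  filterlim (Cprod (fun j => 1 - x * q ^ j)) eventually (locally (qpoch x q)).
Proof.
  intros Hq; pose proof (Cmod_ge_0 q).
  assert (E : forall n, lprod (fun j => 1 - x * q ^ j) (seq 0 n)
                      = Cprod (fun j => 1 - x * q ^ j) n)
    by (intros n; symmetry; apply Cprod_seq).
  assert (HL : filterlim (fun n => lprod (fun j => 1 - x * q ^ j) (seq 0 n)) eventually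
    (locally (Clim eventually (fun n => lprod (fun j => 1 - x * q ^ j) (seq 0 n))))).
  { apply (lprod_lim _ (seq 0) (fun j => Cmod q ^ j * Cmod x)%R
      (/ (1 - Cmod q) * Cmod x)%R).
    - apply exhausting_seq.
    - intros j; rewrite Cmod_factor_sub1, Cmod_pow; right; ring.
    - intros n; rewrite lsum_scal.
      apply Rmult_le_compat_r; [apply Cmod_ge_0 | apply lsum_geom; lra]. }
  apply (filterlim_ext (F := eventually) _ _ E) in HL; rename HL into HL'.
  unfold qpoch, Cinfprod; rewrite (Clim_eq _ _ _ HL'); exact HL'.
Qed.

Lemma filterlim_mul_eventually (n : nat) :
  (1 <= n)%nat -> filterlim (fun M => (n * M)%nat) eventually eventually.
Proof.
  intros Hn P [N HN]; exists N; intros M HM; apply HN; nia.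
Qed.

Lemma Cmod_pow_lt_1 (p : C) (n : nat) :
  (Cmod p < 1)%R -> (1 <= n)%nat -> (Cmod (p ^ n) < 1)%R.
Proof.
  intros Hp Hn; rewrite Cmod_pow.
  apply pow_lt_1_compat; [split; [apply Cmod_ge_0 | exact Hp] | lia].
Qed.

(** Sort the factors by the residue of their index mod n. *)
Lemma qpoch_mult (x p : C) (n : nat) :
  (Cmod p < 1)%R -> (1 <= n)%nat ->
  qpoch x p = Cprod (fun k => qpoch (p ^ k * x) (p ^ n)) n.
Proof.
  intros Hp Hn.
  apply (Clim_unique eventually (fun M => Cprod (fun j => 1 - x * p ^ j) (n * M))).
  - apply (filterlim_comp _ _ _ (fun M => (n * M)%nat) _ _ eventually);
      [apply filterlim_mul_eventually, Hn | apply qpoch_lim, Hp].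
  - eapply filterlim_ext.
    2: apply (filterlim_Cprod eventually
         (fun k => Cprod (fun j => 1 - p ^ k * x * (p ^ n) ^ j))).
    + intros M; cbn beta; rewrite Cprod_blocks, Cprod_exchange.
      apply Cprod_ext; intros j _; apply Cprod_ext; intros k _.
      rewrite Cpow_add_r, Cpow_mult_r; ring.
    + intros k _; apply qpoch_lim, Cmod_pow_lt_1; assumption.
Qed.

Lemma dpoch_mult (p q x : C) (n : nat) :
  (Cmod p < 1)%R -> (Cmod q < 1)%R -> (1 <= n)%nat ->
  dpoch p q x = Cprod (fun k => dpoch (p ^ n) q (p ^ k * x)) n.
Proof.
  intros Hp Hq Hn.
  apply (Clim_unique (filter_prod eventually eventually) (fun MN : nat * nat =>
    Cprod (fun j => Cprod (fun k => 1 - p ^ j * q ^ k * x) (snd MN)) (n * fst MN))).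
  - apply (filterlim_comp _ _ _ (fun MN : nat * nat => ((n * fst MN)%nat, snd MN))
      (fun MN => Cprod (fun j => Cprod (fun k => 1 - p ^ j * q ^ k * x) (snd MN)) (fst MN))
      _ (filter_prod eventually eventually)); [| apply dpoch_lim; assumption].
    apply filterlim_pair; [| apply filterlim_snd].
    apply (filterlim_comp _ _ _ fst (fun M => (n * M)%nat) _ eventually);
      [apply filterlim_fst | apply filterlim_mul_eventually, Hn].
  - eapply filterlim_ext.
    2: apply (filterlim_Cprod (filter_prod eventually eventually)
         (fun k MN => Cprod (fun j =>
            Cprod (fun i => 1 - (p ^ n) ^ j * q ^ i * (p ^ k * x)) (snd MN)) (fst MN))).
    + intros MN; cbn beta; rewrite Cprod_blocks, Cprod_exchange.
      apply Cprod_ext; intros j _; apply Cprod_ext; intros k _.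
      apply Cprod_ext; intros i _.
      rewrite Cpow_add_r, Cpow_mult_r; ring.
    + intros k _; apply dpoch_lim; [apply Cmod_pow_lt_1 |]; assumption.
Qed.

(** Take out the factors with k = 0. *)
Lemma dpoch_shift (p q x : C) :
  (Cmod p < 1)%R -> (Cmod q < 1)%R ->
  dpoch p q x = qpoch x p * dpoch p q (q * x).
Proof.
  intros Hp Hq.
  apply (Clim_unique (filter_prod eventually eventually) (fun MN : nat * nat =>
    Cprod (fun j => Cprod (fun k => 1 - p ^ j * q ^ k * x) (S (snd MN))) (fst MN))).
  - apply (filterlim_comp _ _ _ (fun MN : nat * nat => (fst MN, S (snd MN)))
      (fun MN => Cprod (fun j => Cprod (fun k => 1 - p ^ j * q ^ k * x) (snd MN)) (fst MN))
      _ (filter_prod eventually eventually)); [| apply dpoch_lim; assumption].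
    apply filterlim_pair; [apply filterlim_fst |].
    apply (filterlim_comp _ _ _ snd S _ eventually); [apply filterlim_snd |].
    intros P [N HN]; exists N; intros M HM; apply HN; lia.
  - eapply filterlim_ext.
    2: apply (filterlim_Cmult (filter_prod eventually eventually)
         (fun MN => Cprod (fun j => 1 - x * p ^ j) (fst MN))
         (fun MN => Cprod (fun j =>
            Cprod (fun k => 1 - p ^ j * q ^ k * (q * x)) (snd MN)) (fst MN))).
    + intros MN; cbn beta; rewrite <- Cprod_mult.
      apply Cprod_ext; intros j _; rewrite Cprod_S_l; f_equal.
      * rewrite <- (Cpow_1_l 0) at 2; cbn [Cpow]; ring.
      * apply Cprod_ext; intros k _; rewrite Cpow_S; ring.
    + apply (filterlim_comp _ _ _ fst (Cprod (fun j => 1 - x * p ^ j)) _ eventually);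
        [apply filterlim_fst | apply qpoch_lim, Hp].
    + apply dpoch_lim; assumption.
Qed.

(** * The elliptic gamma function *)

Lemma e2pi_plus (a b : C) : e2pi (a + b) = e2pi a * e2pi b.
Proof. unfold e2pi; rewrite <- Cexp_plus; f_equal; ring. Qed.

Lemma e2pi_neq_0 (a : C) : e2pi a <> 0.
Proof. apply Cexp_neq_0. Qed.

Lemma e2pi_0 : e2pi 0 = 1.
Proof. unfold e2pi; rewrite Cmult_0_r; apply Cexp_0. Qed.

Lemma e2pi_opp (a : C) : e2pi (- a) = / e2pi a.
Proof.
  pose proof (e2pi_neq_0 a) as Ha.
  assert (H : e2pi (- a) * e2pi a = 1).
  { rewrite <- e2pi_plus; replace (- a + a) with (RtoC 0) by ring; apply e2pi_0. }
  replace (e2pi (- a)) with (e2pi (- a) * e2pi a * / e2pi a) by (field; exact Ha).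
  rewrite H; ring.
Qed.

Lemma e2pi_INR (n : nat) (a : C) : e2pi (INR n * a) = e2pi a ^ n.
Proof.
  induction n as [| n IH].
  - cbn [INR Cpow]; rewrite Cmult_0_l; apply e2pi_0.
  - rewrite S_INR, RtoC_plus, Cpow_S, <- IH, <- e2pi_plus; f_equal; ring.
Qed.

Lemma Cmod_e2pi_lt_1 (a : C) : (0 < Im a)%R -> (Cmod (e2pi a) < 1)%R.
Proof.
  intros Ha; unfold e2pi; rewrite Cmod_Cexp, <- exp_0; apply exp_increasing.
  destruct a as [u v]; cbn in *.
  pose proof (Rmult_lt_0_compat _ _ PI_RGT_0 Ha); lra.
Qed.

(** The numerator factor with indices j, k is 1 - q^j r^k (q r / x), so both
    halves of the product have the same shape. *)
Lemma ell_gamma_dpoch (w tau sigma : C) :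
  (0 < Im tau)%R -> (0 < Im sigma)%R ->
  let q := e2pi tau in let r := e2pi sigma in let x := e2pi w in
  dpoch q r x <> 0 ->
  ell_gamma w tau sigma = dpoch q r (q * r / x) / dpoch q r x.
Proof.
  intros Ht Hs q r x Hx.
  pose proof (Cmod_e2pi_lt_1 tau Ht) as Hq; pose proof (Cmod_e2pi_lt_1 sigma Hs) as Hr.
  fold q in Hq; fold r in Hr.
  unfold ell_gamma, Cinfprod2; apply Clim_eq; [typeclasses eauto |].
  eapply filterlim_ext.
  2: apply (filterlim_Cmult (filter_prod eventually eventually)
       (fun MN => Cprod (fun j =>
          Cprod (fun k => 1 - q ^ j * r ^ k * (q * r / x)) (snd MN)) (fst MN))
       (fun MN => / Cprod (fun j =>
          Cprod (fun k => 1 - q ^ j * r ^ k * x) (snd MN)) (fst MN))).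
  - intros [M N]; cbn beta; cbn [fst snd].
    assert (Hf : forall j k, 1 - q ^ j * r ^ k * x <> 0)
      by (intros; apply dpoch_factor_neq_0, Hx).
    rewrite <- Cprod_inv by (intros; apply Cprod_neq_0; intros; apply Hf).
    rewrite <- Cprod_mult; apply Cprod_ext; intros j _.
    rewrite <- Cprod_inv by (intros; apply Hf).
    rewrite <- Cprod_mult; apply Cprod_ext; intros k _.
    unfold Cdiv; f_equal; [| f_equal]; f_equal; f_equal.
    + unfold Cminus; rewrite !e2pi_plus, !e2pi_INR, e2pi_opp.
      rewrite !Cpow_add_r, !Cpow_1_r; fold q r x; ring.
    + rewrite !e2pi_plus, !e2pi_INR; reflexivity.
  - apply dpoch_lim; assumption.
  - apply (filterlim_Cinv (filter_prod eventually eventually)); [exact Hx |].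
    apply dpoch_lim; assumption.
Qed.

Lemma Im_INR_mult (n : nat) (tau : C) :
  (1 <= n)%nat -> (0 < Im tau)%R -> (0 < Im (INR n * tau))%R.
Proof.
  intros Hn Ht; destruct tau as [u v]; cbn in *.
  pose proof (lt_0_INR n Hn); nra.
Qed.

(** In the denominator this is [dpoch_mult]. In the numerator, the factor k on the
    right has argument q^n r / (q^k x) = q^(n-1-k) (q r / x), so [dpoch_mult]
    applies with the order of the factors reversed. *)
Lemma ell_gamma_mult (w tau sigma : C) (n : nat) :
  (0 < Im tau)%R -> (0 < Im sigma)%R -> (1 <= n)%nat ->
  dpoch (e2pi tau) (e2pi sigma) (e2pi w) <> 0 ->
  ell_gamma w tau sigma
  = Cprod (fun k => ell_gamma (w + INR k * tau) (INR n * tau) sigma) n.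
Proof.
  intros Ht Hs Hn Hx.
  pose proof (Im_INR_mult n tau Hn Ht) as Hnt.
  pose proof (Cmod_e2pi_lt_1 tau Ht) as Hq; pose proof (Cmod_e2pi_lt_1 sigma Hs) as Hr.
  rewrite ell_gamma_dpoch by assumption; cbn zeta.
  set (q := e2pi tau) in *; set (r := e2pi sigma) in *; set (x := e2pi w) in *.
  assert (Hq0 : q <> 0) by apply e2pi_neq_0.
  assert (Hx0 : x <> 0) by apply e2pi_neq_0.
  pose proof Hx as Hk; rewrite (dpoch_mult q r x n) in Hk by assumption.
  pose proof (proj1 (Cprod_neq_0 _ _) Hk) as Hk'; cbn beta in Hk'.
  rewrite (dpoch_mult q r x n), (dpoch_mult q r (q * r / x) n) by assumption.
  unfold Cdiv; rewrite <- Cprod_inv by exact Hk'.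
  rewrite <- (Cprod_rev (fun k => dpoch _ _ (q ^ k * _))), <- Cprod_mult.
  apply Cprod_ext; intros k Hkn.
  assert (E : e2pi (w + INR k * tau) = q ^ k * x).
  { rewrite e2pi_plus, e2pi_INR; unfold q, x; ring. }
  rewrite ell_gamma_dpoch; [| assumption | assumption |].
  - cbn zeta; rewrite E, e2pi_INR; fold q r; unfold Cdiv; f_equal; f_equal.
    replace n with (S (n - 1 - k) + k)%nat at 2 by lia.
    rewrite Cpow_add_r, Cpow_S; field.
    split; [exact Hx0 | apply Cpow_nz, Hq0].
  - rewrite E, e2pi_INR; apply Hk', Hkn.
Qed.

(** With Q = q^n, Gamma (k tau, n tau, sigma) has numerator dpoch Q r (q^(n-k) r)
    and denominator dpoch Q r (q^k) = (q^k; Q) dpoch Q r (q^k r). In the product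
    over 1 <= k < n the substitution k -> n - k cancels the double products and
    leaves the product of 1 / (q^k; Q), which by [qpoch_mult] is
    (Q; Q) / (q; q). *)
Lemma qpoch_ell_gamma_prod (tau sigma : C) (m : nat) :
  (0 < Im tau)%R -> (0 < Im sigma)%R ->
  let q := e2pi tau in
  qpoch q q * Cprod (fun i => ell_gamma (INR (i + 1) * tau) (INR (S m) * tau) sigma) m
  = qpoch (q ^ S m) (q ^ S m).
Proof.
  intros Ht Hs q.
  assert (Hm : (1 <= S m)%nat) by lia.
  pose proof (Im_INR_mult (S m) tau Hm Ht) as Hnt.
  pose proof (Cmod_e2pi_lt_1 tau Ht) as Hq; pose proof (Cmod_e2pi_lt_1 sigma Hs) as Hr.
  fold q in Hq; set (r := e2pi sigma) in *.
  pose proof (Cmod_pow_lt_1 q (S m) Hq Hm) as HQ; set (Q := q ^ S m) in *.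
  assert (Hq0 : q <> 0) by apply e2pi_neq_0.
  (* The index i = k - 1 starts at 0. *)
  set (a := fun i => qpoch (q ^ i * q) Q).
  set (b := fun i => dpoch Q r (r * (q ^ i * q))).
  assert (Hab : forall i, dpoch Q r (q ^ i * q) = a i * b i)
    by (intros; apply dpoch_shift; assumption).
  assert (Hi : forall i, (Cmod (q ^ i * q) < 1)%R).
  { intros i; rewrite Cmult_comm, <- Cpow_S; apply Cmod_pow_lt_1; [exact Hq | lia]. }
  assert (Hab0 : forall i, a i * b i <> 0)
    by (intros i; rewrite <- Hab; apply dpoch_neq_0; auto).
  assert (Ha0 : forall i, a i <> 0)
    by (intros i E; apply (Hab0 i); rewrite E; ring).
  assert (Hb0 : forall i, b i <> 0)
    by (intros i E; apply (Hab0 i); rewrite E; ring).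
  rewrite (qpoch_mult q q (S m)) by assumption; fold Q; cbn [Cprod].
  replace (q ^ m * q) with Q by (unfold Q; rewrite Cpow_S; ring).
  rewrite (Cprod_ext (fun i => ell_gamma _ _ _)
    (fun i => b (m - 1 - i)%nat * (/ a i * / b i))).
  - rewrite !Cprod_mult, !Cprod_inv, Cprod_rev by auto.
    fold a; field.
    split; apply Cprod_neq_0; auto.
  - intros i Him.
    assert (E : e2pi (INR (i + 1) * tau) = q ^ i * q)
      by (rewrite e2pi_INR, Cpow_add_r, Cpow_1_r; reflexivity).
    rewrite ell_gamma_dpoch; [| assumption | assumption |]; cbn zeta;
      rewrite E, e2pi_INR; fold q r Q; rewrite Hab; [| apply Hab0].
    unfold b at 2.
    replace (Q * r / (q ^ i * q)) with (r * (q ^ (m - 1 - i) * q)).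
    + unfold b; field; split; [apply Hb0 | apply Ha0].
    + unfold Q; replace (S m) with (S (m - 1 - i) + (i + 1))%nat by lia.
      rewrite Cpow_add_r, Cpow_S, Cpow_add_r, Cpow_1_r; field.
      split; [exact Hq0 | apply Cpow_nz, Hq0].
Qed.

(** * Meromorphic functions *)

Lemma holomorphic_entire (f : C -> C) (z : C) :
  (forall y, Cdifferentiable f y) -> holomorphic_at f z.
Proof. intros H; apply (filter_forall (F := locally z)); exact H. Qed.

Lemma locally'_and (z : C) (P Q : C -> Prop) :
  locally' z P -> locally' z Q -> locally' z (fun y => P y /\ Q y).
Proof.
  intros HP HQ; apply (filter_imp (F := locally z)) with (2 := filter_and (F := locally z) _ _ HP HQ).
  intros y [H1 H2] Hy; auto.
Qed.

Lemma locally'_imp (z : C) (P Q : C -> Prop) :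
  (forall y, P y -> Q y) -> locally' z P -> locally' z Q.
Proof. intros H HP; apply (filter_imp (F := locally z)) with (2 := HP); intros y Hy Hz; auto. Qed.

Lemma meromorphic_ext (f g : C -> C) :
  (forall z, f z = g z) -> meromorphic f -> meromorphic g.
Proof.
  intros E Hf z0; destruct (Hf z0) as [a [b [Ha [Hb H]]]].
  exists a, b; repeat split; [assumption | assumption |].
  apply locally'_imp with (2 := H); intros y; rewrite E; auto.
Qed.

Lemma meromorphic_entire (f : C -> C) :
  (forall z, Cdifferentiable f z) -> meromorphic f.
Proof.
  intros Hf z0; exists f, (fun _ => 1); split; [| split].
  - apply holomorphic_entire, Hf.
  - apply holomorphic_entire; intros; apply Cdifferentiable_const.
  - apply (filter_forall (F := locally _)); intros y _; split; [| field]; intros E; injection E; lra.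
Qed.

Lemma holomorphic_mult (f g : C -> C) (z : C) :
  holomorphic_at f z -> holomorphic_at g z -> holomorphic_at (fun y => f y * g y) z.
Proof.
  intros Hf Hg; apply (filter_imp (F := locally z)) with (2 := filter_and (F := locally z) _ _ Hf Hg).
  intros y [H1 H2]; apply Cdifferentiable_mult; assumption.
Qed.

Lemma meromorphic_mult (f g : C -> C) :
  meromorphic f -> meromorphic g -> meromorphic (fun z => f z * g z).
Proof.
  intros Hf Hg z0.
  destruct (Hf z0) as [a [b [Ha [Hb H1]]]]; destruct (Hg z0) as [c [d [Hc [Hd H2]]]].
  exists (fun z => a z * c z), (fun z => b z * d z).
  split; [| split]; [apply holomorphic_mult; assumption.. |].
  apply locally'_imp with (2 := locally'_and _ _ _ H1 H2).
  intros y [[Hb0 Ef] [Hd0 Eg]]; split; [apply Cmult_neq_0; assumption |].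
  rewrite Ef, Eg; field; auto.
Qed.

Lemma meromorphic_Cprod (f : nat -> C -> C) (n : nat) :
  (forall k, meromorphic (f k)) -> meromorphic (fun z => Cprod (fun k => f k z) n).
Proof.
  intros H; induction n as [| n IH]; cbn [Cprod].
  - apply meromorphic_entire; intros; apply Cdifferentiable_const.
  - apply meromorphic_mult; auto.
Qed.

Lemma Cdifferentiable_Cexp_affine (a b z : C) :
  Cdifferentiable (fun y => Cexp (a * y + b)) z.
Proof.
  apply (Cdifferentiable_comp Cexp (fun y => a * y + b)).
  - eexists; apply is_derive_Cexp.
  - eexists; apply is_derive_affine.
Qed.

Lemma is_derive_e2pi_affine (a b z : C) :
  @is_derive C_AbsRing C_NormedModule (fun y => e2pi (a * y + b)) z
    (2 * PI * Ci * a * e2pi (a * z + b)).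
Proof.
  pose proof (is_derive_comp (K := C_AbsRing) (V := C_NormedModule) Cexp
    (fun y => 2 * PI * Ci * a * y + 2 * PI * Ci * b) z _ _
    (is_derive_Cexp _) (proj1 (is_derive_AbsRing _ _ _) (is_derive_affine _ _ z))) as H.
  cbn beta in H.
  replace (2 * PI * Ci * a * z + 2 * PI * Ci * b) with (2 * PI * Ci * (a * z + b))
    in H by ring.
  eapply is_derive_ext; [| exact H].
  intros y; unfold e2pi; f_equal; ring.
Qed.

(** Near z the values of e2pi are bounded, so only finitely many factors can
    vanish ([dpoch_neq_0_bounded]), and each of them does so at isolated points
    because the derivative of e2pi (a y + b) is nowhere 0. *)
Lemma dpoch_e2pi_neq_0 (p q a b z : C) :
  (Cmod p < 1)%R -> (Cmod q < 1)%R -> p <> 0 -> q <> 0 -> a <> 0 ->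
  locally' z (fun y => dpoch p q (e2pi (a * y + b)) <> 0).
Proof.
  intros Hp Hq Hp0 Hq0 Ha.
  set (e := fun y => e2pi (a * y + b)).
  pose proof (is_derive_e2pi_affine a b z) as Hd; fold e in Hd.
  assert (H2pi : 2 * PI * Ci <> 0).
  { intros E; injection E; pose proof PI_RGT_0; lra. }
  assert (Hd0 : 2 * PI * Ci * a * e z <> 0).
  { repeat apply Cmult_neq_0; try assumption; try apply e2pi_neq_0;
      intros E; apply H2pi; rewrite E; ring. }
  destruct (dpoch_neq_0_bounded p q (Cmod (e z) + 1) Hp Hq) as [l Hl].
  { pose proof (Cmod_ge_0 (e z)); lra. }
  assert (Hb : locally' z (fun y => (Cmod (e y) <= Cmod (e z) + 1)%R)).
  { apply filter_imp with (2 := Cdifferentiable_continuous e z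
      (ex_intro _ _ Hd) 1 Rlt_0_1).
    intros y Hy _.
    replace (e y) with (e z + (e y - e z)) by ring.
    eapply Rle_trans; [apply Cmod_triangle |]; lra. }
  assert (Hf : locally' z (fun y => forall jk, In jk l ->
    1 - p ^ fst jk * q ^ snd jk * e y <> 0)).
  { clear Hl; induction l as [| [j k] l IH].
    - apply (filter_forall (F := locally _)); intros y _ jk [].
    - set (s := p ^ j * q ^ k).
      assert (Hs : s <> 0) by (apply Cmult_neq_0; apply Cpow_nz; assumption).
      apply locally'_imp with (2 := locally'_and _ _ _
        (locally'_neq e z _ (/ s) Hd Hd0) IH).
      intros y [H1 H2] jk [<- | Hjk]; [| apply H2, Hjk].
      cbn [fst snd]; fold s; intros E; apply H1.
      replace (e y) with ((1 - (1 - s * e y)) / s) by (field; exact Hs).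
      rewrite E; field; exact Hs. }
  apply locally'_imp with (2 := locally'_and _ _ _ Hb Hf).
  intros y [H1 H2]; apply Hl; assumption.
Qed.

Lemma Cdifferentiable_dpoch_e2pi (p q s a b z : C) :
  (Cmod p < 1)%R -> (Cmod q < 1)%R ->
  Cdifferentiable (fun y => dpoch p q (s * e2pi (a * y + b))) z.
Proof.
  intros Hp Hq.
  apply (Cdifferentiable_comp (dpoch p q) (fun y => s * e2pi (a * y + b))).
  - apply dpoch_entire; assumption.
  - apply Cdifferentiable_mult; [apply Cdifferentiable_const |].
    eexists; apply is_derive_e2pi_affine.
Qed.

Lemma meromorphic_ell_gamma (tau sigma a b : C) :
  (0 < Im tau)%R -> (0 < Im sigma)%R -> a <> 0 ->
  meromorphic (fun z => ell_gamma (a * z + b) tau sigma).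
Proof.
  intros Ht Hs Ha z0.
  pose proof (Cmod_e2pi_lt_1 tau Ht) as Hq; pose proof (Cmod_e2pi_lt_1 sigma Hs) as Hr.
  set (q := e2pi tau) in *; set (r := e2pi sigma) in *.
  exists (fun z => dpoch q r (q * r * e2pi (- a * z + - b))),
    (fun z => dpoch q r (1 * e2pi (a * z + b))).
  split; [| split].
  - apply holomorphic_entire; intros; apply Cdifferentiable_dpoch_e2pi; assumption.
  - apply holomorphic_entire; intros; apply Cdifferentiable_dpoch_e2pi; assumption.
  - assert (H : locally' z0 (fun y => dpoch q r (e2pi (a * y + b)) <> 0)).
    { apply dpoch_e2pi_neq_0; try assumption; apply e2pi_neq_0. }
    apply locally'_imp with (2 := H); intros y Hy; rewrite Cmult_1_l.
    split; [exact Hy |].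
    rewrite ell_gamma_dpoch by assumption; cbn zeta; fold q r.
    replace (- a * y + - b) with (- (a * y + b)) by ring.
    rewrite e2pi_opp; reflexivity.
Qed.

Lemma meromorphic_gamma_bar (L tau sigma a b : C) :
  (0 < Im tau)%R -> (0 < Im sigma)%R -> a <> 0 ->
  meromorphic (fun z => gamma_bar L (a * z + b) tau sigma).
Proof.
  intros Ht Hs Ha; unfold gamma_bar; cbn zeta.
  apply (meromorphic_mult (fun z => qpoch (e2pi tau) (e2pi tau)
    / qpoch (e2pi sigma) (e2pi sigma) * Cexp ((1 - (a * z + b)) * L))).
  - apply meromorphic_entire; intros z; apply Cdifferentiable_mult;
      [apply Cdifferentiable_const |].
    apply (Cdifferentiable_ext (fun z => Cexp (- a * L * z + (1 - b) * L))).
    + intros y; f_equal; ring.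
    + apply Cdifferentiable_Cexp_affine.
  - apply (meromorphic_ext (fun z => ell_gamma (a * tau * z + b * tau) tau sigma)).
    + intros z; f_equal; ring.
    + apply meromorphic_ell_gamma; [assumption.. |].
      apply Cmult_neq_0; [exact Ha |].
      intros E; rewrite E in Ht; cbn in Ht; lra.
Qed.

(** Both functions are continuous at z. *)
Lemma holomorphic_eq (f g : C -> C) (z : C) :
  holomorphic_at f z -> holomorphic_at g z ->
  locally' z (fun y => f y = g y) -> f z = g z.
Proof.
  intros Hf Hg H.
  pose proof (locally_singleton _ _ Hf) as Hf'.
  pose proof (locally_singleton _ _ Hg) as Hg'.
  destruct (Ceq_dec (f z) (g z)) as [E | E]; [exact E | exfalso].
  assert (Hd : (0 < Cmod (f z - g z) / 2)%R).
  { apply Rdiv_lt_0_compat; [| lra]; apply Cmod_gt_0; intros E0; apply E.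
    replace (f z) with (f z - g z + g z) by ring; rewrite E0; ring. }
  pose proof (filter_and (F := locally z) _ _ H (filter_and _ _
    (Cdifferentiable_continuous f z Hf' _ Hd)
    (Cdifferentiable_continuous g z Hg' _ Hd))) as Hall.
  apply locally_Cmod in Hall; destruct Hall as [d [Hd0 Hall]].
  assert (Hm : Cmod (z + (d / 2)%R - z) = (d / 2)%R).
  { replace (z + (d / 2)%R - z) with (RtoC (d / 2)) by ring.
    rewrite Cmod_R; apply Rabs_pos_eq; lra. }
  destruct (Hall (z + (d / 2)%R)) as [H1 [H2 H3]]; [lra |].
  set (y := z + (d / 2)%R) in *.
  assert (Hyz : y <> z).
  { intros E0; rewrite E0 in Hm.
    replace (z - z) with (RtoC 0) in Hm by ring; rewrite Cmod_0 in Hm; lra. }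
  specialize (H1 Hyz); rewrite H1 in H2.
  pose proof (Cmod_triangle (- (g y - f z)) (g y - g z)) as H4.
  replace (- (g y - f z) + (g y - g z)) with (f z - g z) in H4 by ring.
  rewrite Cmod_opp in H4; lra.
Qed.

(** * The multiplication formula *)

(** Each factor on the right contributes exp (- z Ln) exp ((1 - k / n) Ln), the
    second part of which it shares, for k >= 1, with the corresponding factor on
    the left. Here k = 0 leaves exp Ln, and
    (1 - n z) L1 = (n z - 1) (Ln - L1) - n z Ln + Ln balances the rest. *)
Lemma gamma_bar_mult (tau sigma L1 Ln z : C) (n : nat) :
  (0 < Im tau)%R -> (0 < Im sigma)%R -> (1 <= n)%nat ->
  dpoch (e2pi tau) (e2pi sigma) (e2pi (INR n * z * tau)) <> 0 ->
  gamma_bar L1 (INR n * z) tau sigma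
  * Cprod (fun i => gamma_bar Ln (INR (i + 1) / INR n) (INR n * tau) sigma) (n - 1)
  = Cexp ((INR n * z - 1) * (Ln - L1))
    * Cprod (fun k => gamma_bar Ln (z + INR k / INR n) (INR n * tau) sigma) n.
Proof.
  intros Ht Hs Hn Hx.
  destruct n as [| m]; [lia |].
  replace (S m - 1)%nat with m by lia.
  assert (HN : RtoC (INR (S m)) <> 0).
  { intros E; apply RtoC_inj in E; pose proof (lt_0_INR (S m) Hn); lra. }
  pose proof (qpoch_ell_gamma_prod tau sigma m Ht Hs) as HA; cbn zeta in HA.
  pose proof (ell_gamma_mult _ tau sigma (S m) Ht Hs Hn Hx) as HG.
  set (N := INR (S m)) in *.
  set (q := e2pi tau) in *.
  assert (EN : e2pi (N * tau) = q ^ S m) by apply e2pi_INR.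
  set (c := qpoch (q ^ S m) (q ^ S m) * / qpoch (e2pi sigma) (e2pi sigma)).
  assert (El : forall i, gamma_bar Ln (INR (i + 1) / N) (N * tau) sigma
    = c * Cexp ((1 - INR (i + 1) / N) * Ln) * ell_gamma (INR (i + 1) * tau) (N * tau) sigma).
  { intros i; unfold gamma_bar; cbn zeta; rewrite EN; unfold Cdiv at 1; fold c; f_equal; f_equal; field; exact HN. }
  assert (Er : forall k, gamma_bar Ln (z + INR k / N) (N * tau) sigma
    = c * (Cexp (- z * Ln) * Cexp ((1 - INR k / N) * Ln))
      * ell_gamma (N * z * tau + INR k * tau) (N * tau) sigma).
  { intros k; unfold gamma_bar; cbn zeta; rewrite EN; unfold Cdiv at 1; fold c; rewrite <- Cexp_plus.
    f_equal; [f_equal; f_equal; field | f_equal; field]; exact HN. }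
  rewrite (Cprod_ext _ _ _ (fun i _ => El i)), (Cprod_ext _ _ _ (fun i _ => Er i)).
  rewrite !Cprod_mult, <- HG.
  set (P := Cprod (fun i => ell_gamma _ _ _) m) in *.
  rewrite (Cprod_S_l (fun k => Cexp ((1 - INR k / N) * Ln))).
  rewrite (Cprod_ext (fun i => Cexp ((1 - INR (S i) / N) * Ln))
    (fun i => Cexp ((1 - INR (i + 1) / N) * Ln)))
    by (intros i _; rewrite Nat.add_1_r; reflexivity).
  set (E := Cprod (fun i => Cexp ((1 - INR (i + 1) / N) * Ln)) m).
  assert (Hz : forall k, Cprod (fun _ => Cexp (- z * Ln)) k = Cexp (INR k * (- z * Ln))).
  { induction k as [| k IH]; cbn [Cprod].
    - cbn [INR]; rewrite Cmult_0_l, Cexp_0; reflexivity.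
    - rewrite IH, <- Cexp_plus, S_INR, RtoC_plus; f_equal; ring. }
  rewrite Hz; fold N.
  unfold gamma_bar; cbn zeta; fold q.
  set (G := ell_gamma (N * z * tau) tau sigma).
  assert (Ee : Cexp ((1 - N * z) * L1)
    = Cexp ((N * z - 1) * (Ln - L1)) * Cexp (N * (- z * Ln)) * Cexp ((1 - INR 0 / N) * Ln)).
  { rewrite <- !Cexp_plus; f_equal; cbn [INR]; field; exact HN. }
  rewrite Ee; cbn [Cprod].
  replace (qpoch q q / qpoch (e2pi sigma) (e2pi sigma)) with
    (qpoch q q * / qpoch (e2pi sigma) (e2pi sigma)) by reflexivity.
  transitivity (qpoch q q * P * / qpoch (e2pi sigma) (e2pi sigma)
    * (Cexp ((N * z - 1) * (Ln - L1)) * Cexp (N * (- z * Ln)) * Cexp ((1 - INR 0 / N) * Ln))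
    * G * Cprod (fun _ => c) m * E); [ring |].
  rewrite HA; fold c; ring.
Qed.

Theorem mainTheorem2 :
  forall (tau sigma : C) (n : nat) (L1 Ln : C),
    (0 < Im tau)%R -> (0 < Im sigma)%R ->
    (1 <= n)%nat ->
    ~ (exists a b : Z, INR n * tau = IZR a + IZR b * sigma) ->
    Cexp L1 = theta0 tau sigma ->
    Cexp Ln = theta0 (INR n * tau) sigma ->
    (n = 1%nat -> Ln = L1) ->
    meromorphic_eq
      (fun z : C =>
         gamma_bar L1 (INR n * z) tau sigma
         * Cprod (fun i => gamma_bar Ln (INR (i + 1) / INR n)
                             (INR n * tau) sigma) (n - 1))
      (fun z : C =>
         Cexp ((INR n * z - 1) * (Ln - L1))
         * Cprod (fun k => gamma_bar Ln (z + INR k / INR n)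
                             (INR n * tau) sigma) n).
Proof.
  intros tau sigma n L1 Ln Ht Hs Hn _ _ _ _.
  assert (HN : RtoC (INR n) <> 0).
  { intros E; apply RtoC_inj in E; pose proof (lt_0_INR n Hn); lra. }
  pose proof (Im_INR_mult n tau Hn Ht) as Hnt.
  split; [| split].
  - apply (meromorphic_mult (fun z => gamma_bar L1 (INR n * z) tau sigma)).
    + apply (meromorphic_ext (fun z => gamma_bar L1 (INR n * z + 0) tau sigma)).
      * intros z; f_equal; ring.
      * apply meromorphic_gamma_bar; assumption.
    + apply meromorphic_entire; intros; apply Cdifferentiable_const.
  - apply (meromorphic_mult (fun z => Cexp ((INR n * z - 1) * (Ln - L1)))).
    + apply meromorphic_entire; intros z.
      apply (Cdifferentiable_ext (fun z => Cexp (INR n * (Ln - L1) * z + - (Ln - L1)))).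
      * intros y; f_equal; ring.
      * apply Cdifferentiable_Cexp_affine.
    + apply (meromorphic_Cprod (fun k z =>
        gamma_bar Ln (z + INR k / INR n) (INR n * tau) sigma)); intros k.
      apply (meromorphic_ext (fun z =>
        gamma_bar Ln (1 * z + INR k / INR n) (INR n * tau) sigma)).
      * intros z; f_equal; ring.
      * apply meromorphic_gamma_bar; [assumption.. |].
        intros E; injection E; lra.
  - intros z Hf Hg.
    refine (holomorphic_eq _ _ z Hf Hg _).
    assert (H : locally' z (fun y => dpoch (e2pi tau) (e2pi sigma)
      (e2pi (INR n * tau * y + 0)) <> 0)).
    { apply dpoch_e2pi_neq_0.
      - apply Cmod_e2pi_lt_1, Ht.
      - apply Cmod_e2pi_lt_1, Hs.
      - apply e2pi_neq_0.
      - apply e2pi_neq_0.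
      - apply Cmult_neq_0; [exact HN |].
        intros E; rewrite E in Ht; cbn in Ht; lra. }
    apply locally'_imp with (2 := H); intros y Hy.
    apply gamma_bar_mult; [assumption.. |].
    replace (INR n * y * tau) with (INR n * tau * y + 0) by ring; exact Hy.
Qed.
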